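(* Let $p$ be a prime, let $\nu$ be a positive integer and let $k\ge 0$ be an integer. Let $A$ be a finite abelian group of order $m$ such that $p\nmid m$. Then the following statements hold. 1. $\mathrm{avg}_{p^{2\nu}}^{\rm H}(A\times\mathbb{Z}_{p^k})<\frac{mp^k}{3}$. 2. $\mathrm{avg}_{p^{2\nu}}^{\rm H}(A)=\frac{m-|R_{p^{2\nu}}(A)|}{4}$. 3. $\mathrm{avg}_{p^{2\nu}}^{\rm H}(A)\le\frac{m-1}{4}$.
   Context: For a finite abelian group $G$ (written additively), $\mathbb{F}_{p^{2\nu}}[G]$ is the group algebra, with elements written $\sum_{g\in G}u_gY^g$. An abelian code in $\mathbb{F}_{p^{2\nu}}[G]$ is an ideal of $\mathbb{F}_{p^{2\nu}}[G]$, and $\mathcal{C}(p^{2\nu},G)$ is the set of all of them. The Hermitian inner product is $\langle u,v\rangle_{\rm H}=\sum_{g\in G}u_gv_g^{p^\nu}$; the Hermitian dual of a code $C$ is $C^{\perp_{\rm H}}=\{v\in\mathbb{F}_{p^{2\nu}}[G] : \langle c,v\rangle_{\rm H}=0 \text{ for all } c\in C\}$, and the Hermitian hull is $\mathcal{H}_{\rm H}(C)=C\cap C^{\perp_{\rm H}}$. The average dimension of the Hermitian hull is $$\mathrm{avg}_{p^{2\nu}}^{\rm H}(G)=\frac{\sum_{C\in\mathcal{C}(p^{2\nu},G)}\dim_{\mathbb{F}_{p^{2\nu}}}(\mathcal{H}_{\rm H}(C))}{|\mathcal{C}(p^{2\nu},G)|}.$$ For $q$ coprime to $|A|$, the $q$-cyclotomic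 class of $a\in A$ is $S_q(a)=\{q^i\cdot a : i=0,1,2,\dots\}$, and $R_{p^{2\nu}}(A)=\{a\in A : -p^\nu\cdot a\in S_{p^{2\nu}}(a)\}$. $\mathbb{Z}_{p^k}$ is the cyclic group of order $p^k$. *)

(* Defs.v *)
(* MathComp *)
From HB Require Import structures.
From mathcomp Require Import all_boot all_order all_algebra.
From mathcomp Require finfield.

Set Implicit Arguments.
Unset Strict Implicit.
Unset Printing Implicit Defensive.
#[local] Set Warnings "-redundant-canonical-projection".

Import Order.TTheory GRing.Theory Num.Theory.
Local Open Scope ring_scope.

(* finZmodType does not come with a product instance. *)
HB.saturate prod.

(* An alias of the space of coefficient functions: u g is the coefficient of
   Y^g. {ffun _} itself carries the pointwise product, hence the alias. *)
Definition group_algebra (F : finFieldType) (G : finZmodType) : Type :=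
  {ffun G -> F^o}.

Section GroupAlgebra.
Variables (F : finFieldType) (G : finZmodType).
Local Notation FG := (group_algebra F G).
Implicit Types (u v w : FG) (g h : G).

HB.instance Definition _ := Finite.copy FG {ffun G -> F^o}.
HB.instance Definition _ := Vector.copy FG {ffun G -> F^o}.

Definition galg_mono g : FG := [ffun h => (h == g)%:R].
Definition galg_mul u v : FG := [ffun g => \sum_h u h * v (g - h)].

Fact galg_mulC : commutative galg_mul.
Proof.
move=> u v; apply/ffunP=> g; rewrite !ffunE.
rewrite (reindex_inj (can_inj (fun h => subKr g h))) /=.
by apply: eq_bigr => h _; rewrite subKr mulrC.
Qed.

Fact galg_mulA : associative galg_mul.
Proof.
move=> u v w; apply/ffunP=> g; rewrite !ffunE.
under eq_bigr => h _ do rewrite ffunE big_distrr /=.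
under [RHS]eq_bigr => h _ do rewrite ffunE big_distrl /=.
rewrite [RHS]exchange_big /=; apply: eq_bigr => h _.
rewrite [RHS](reindex_inj (addrI h)) /=; apply: eq_bigr => k _.
have -> : h + k - h = k by rewrite addrC addKr.
by rewrite mulrA opprD addrA.
Qed.

Fact galg_mul1 : left_id (galg_mono 0) galg_mul.
Proof.
move=> u; apply/ffunP=> g; rewrite ffunE (bigD1 0) //= ffunE eqxx mul1r subr0.
by rewrite big1 ?addr0 // => h /negPf h0; rewrite ffunE h0 mul0r.
Qed.

Fact galg_mulDl : left_distributive galg_mul +%R.
Proof.
move=> u v w; apply/ffunP=> g; rewrite !ffunE -big_split /=.
by apply: eq_bigr => h _; rewrite ffunE mulrDl.
Qed.

Fact galg_mono0_neq0 : galg_mono 0 != 0.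
Proof.
by apply/eqP=> /ffunP/(_ 0)/eqP; rewrite !ffunE eqxx oner_eq0.
Qed.

HB.instance Definition _ := GRing.Zmodule_isComNzRing.Build FG
  galg_mulA galg_mulC galg_mul1 galg_mulDl galg_mono0_neq0.

Fact galg_scaleAl (c : F) u v : c *: (u * v) = (c *: u) * v.
Proof.
apply/ffunP=> g; rewrite !ffunE scaler_sumr.
by apply: eq_bigr => h _; rewrite !ffunE -scalerAl.
Qed.

HB.instance Definition _ := GRing.Lmodule_isLalgebra.Build F FG galg_scaleAl.

Lemma galg_mulE u v g : (u * v) g = \sum_h u h * v (g - h).
Proof. by rewrite ffunE. Qed.

Lemma galg_monoD g h : galg_mono g * galg_mono h = galg_mono (g + h).
Proof.
apply/ffunP=> k; rewrite galg_mulE (bigD1 g) //= !ffunE eqxx mul1r subr_eq.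
by rewrite [h + g]addrC big1 ?addr0 // => x /negPf xg; rewrite ffunE xg mul0r.
Qed.

Lemma galg_sum_mono u : u = \sum_g u g *: galg_mono g.
Proof.
apply/ffunP=> g; rewrite sum_ffunE (bigD1 g) //= !ffunE eqxx.
rewrite big1 => [|h]; first by rewrite addr0 /GRing.scale /= mulr1.
by rewrite eq_sym !ffunE => /negPf->; rewrite scaler0.
Qed.

End GroupAlgebra.

Definition is_ideal (R : finComNzRingType) (I : {set R}) : bool :=
  [&& 0 \in I, [forall u in I, forall v in I, u + v \in I]
    & [forall a, forall u in I, a * u \in I]].

Section HermitianHull.
Variables (p nu : nat) (F : finFieldType) (G : finZmodType).
Local Notation FG := (group_algebra F G).
Implicit Types (u v : FG) (C D : {set FG}).

Definition abelian_codes : {set {set FG}} := [set C | is_ideal C].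

Definition hermitian_dot u v : F := \sum_g u g * v g ^+ (p ^ nu).

Definition hermitian_dual C : {set FG} :=
  [set v | [forall c in C, hermitian_dot c v == 0]].

Definition hermitian_hull C : {set FG} := C :&: hermitian_dual C.

(* Dimension of the span; see hermitian_hull_span: the hull of a code is
   already a subspace. *)
Definition code_dim C : nat := \dim <<enum C>>%VS.

(* Meant for #|F| = p ^ (2 * nu). *)
Definition avg_hermitian_hull : rat :=
  (\sum_(C in abelian_codes) code_dim (hermitian_hull C))%:R
    / #|abelian_codes|%:R.

Lemma hermitian_hull_span C :
  prime p -> #|F| = (p ^ (2 * nu))%N -> C \in abelian_codes ->
  <<enum (hermitian_hull C)>>%VS =i hermitian_hull C.
Proof.
move=> p_pr cardF; rewrite inE => /and3P[C0 /forall_inP CD /forallP CM] x.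
have pF : [pchar F].-nat (p ^ nu)%N.
  have pcharFp := finfield.card_finPcharP cardF p_pr.
  by rewrite pnatX (eq_pnat _ (pcharf_eq pcharFp)) pnat_id.
have q_gt0 : (0 < p ^ nu)%N by rewrite expn_gt0 prime_gt0.
apply/idP/idP => [xH | xH]; last by rewrite memv_span ?mem_enum.
rewrite (coord_span xH); apply: (big_ind (fun y => y \in hermitian_hull C)).
- rewrite !inE C0; apply/forall_inP => c _; apply/eqP.
  by apply: big1 => g _; rewrite ffunE expr0n gtn_eqF ?mulr0.
- move=> u v; rewrite !inE => /andP[Cu /forall_inP Du] /andP[Cv /forall_inP Dv].
  have /forall_inP -> // := CD u Cu; apply/forall_inP => c Cc.
  rewrite -(addr0 0) -{1}(eqP (Du c Cc)) -(eqP (Dv c Cc)) -big_split /=.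
  by apply/eqP/eq_bigr => g _; rewrite ffunE exprDn_pchar // mulrDr.
move=> i _; set u := _`_i; set a := coord _ _ _.
have : u \in hermitian_hull C
  by rewrite -mem_enum; apply: mem_nth; rewrite -cardE.
rewrite !inE => /andP[Cu /forall_inP Du].
rewrite -[u]mul1r scalerAl; have /forall_inP -> // := CM (a *: 1).
rewrite -scalerAl mul1r.
apply/forall_inP => c Cc; rewrite -(mulr0 (a ^+ (p ^ nu))) -(eqP (Du c Cc)).
rewrite big_distrr /=; apply/eqP/eq_bigr => g _.
by rewrite ffunE exprMn mulrCA.
Qed.

End HermitianHull.

Definition cyclotomic_class (A : finZmodType) (q : nat) (a : A) : {set A} :=
  [set b | fconnect (fun x : A => x *+ q) a b].

Lemma cyclotomic_classP (A : finZmodType) (q : nat) (a b : A) :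
  reflect (exists i, b = a *+ (q ^ i)) (b \in cyclotomic_class q a).
Proof.
have iterE i : iter i (fun x : A => x *+ q) a = a *+ (q ^ i).
  by elim: i => [|i IHi] /=; rewrite ?IHi ?expnSr ?mulrnA.
rewrite inE; apply: (iffP idP) => [/iter_findex <- | [i ->]].
  by rewrite iterE; eexists.
by rewrite -iterE fconnect_iter.
Qed.

(* 'Z_n is ordinals of n only for n > 1: 'Z_1 has two elements. *)
Definition cyclic_group (n : nat) : finZmodType := 'I_n.-1.+1.

Lemma card_cyclic_group n : (0 < n)%N -> #|cyclic_group n| = n.
Proof. by move=> n_gt0; rewrite card_ord prednK. Qed.

Definition R_class (p nu : nat) (A : finZmodType) : {set A} :=
  [set a : A | - (a *+ (p ^ nu)) \in cyclotomic_class (p ^ (2 * nu)) a].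

(* Main.v *)
(* Write q = p^nu, N = p^k, G = A x Z_N and x = Y^z - 1 with z a generator
   of Z_N. For a suitable power Q of q^2, u |-> u^Q is a retraction of F[G]
   onto the subalgebra F[A], and u - u^Q is divisible by x. So for a primitive
   idempotent e every element of e F[G] is either invertible there or divisible
   by x: e F[G] is a chain ring with ideals e x^s F[G], s <= N, whose
   dimensions are (N - s) d_e. Ideals of F[G] thus correspond to functions s
   from primitive idempotents to {0, ..., N}, and taking hulls replaces s_e by
   max (s_e, N - s_(conj e)). The hull therefore has dimension
   sum_e d_e min (N - s_e, s_(conj e)), whose average over s is
   sum_e d_e N(2N+1)/(6(N+1)) over the e that are not self-conjugate, plus
   sum_e d_e floor(N^2/4)/(N+1) over those that are.

   For N = 1 it remains to see that the self-conjugate components have total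
   dimension #|R|. The ring automorphism u |-> (conj u)^q is F-linear and
   permutes the monomials by a |-> -q a; some odd power P of it fixes both the
   self-conjugate components and the functions supported on R, and swaps the
   other components, respectively the other elements, in pairs. Comparing in two
   ways the fixed points of P and of P^2 gives the equality. *)
Require Import Defs.
From HB Require Import structures.
From mathcomp Require Import all_boot all_order all_algebra.
From mathcomp Require Import finfield fingroup cyclic zify.

Set Implicit Arguments.
Unset Strict Implicit.
Unset Printing Implicit Defensive.

Import Order.TTheory GRing.Theory Num.Theory.
Local Open Scope ring_scope.

(** * Conjugation on the group algebra *)

Section GroupAlgebraBasics.
Variables (F : finFieldType) (G : finZmodType).
Local Notation FG := (group_algebra F G).
Implicit Types (u v w : FG) (g h : G) (c : F).

Lemma galg_scaleE c u g : (c *: u) g = c * u g.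
Proof. by rewrite ffunE. Qed.

Lemma galg_scaleAr c u v : c *: (u * v) = u * (c *: v).
Proof. by rewrite mulrC scalerAl mulrC. Qed.

Lemma galg_exprZ c u n : (c *: u) ^+ n = c ^+ n *: u ^+ n.
Proof.
elim: n => [|n IHn]; first by rewrite !expr0 scale1r.
by rewrite !exprS IHn -scalerAl -galg_scaleAr scalerA.
Qed.

Lemma galg_mono0 : galg_mono F (0 : G) = 1.
Proof. by []. Qed.

Lemma galg_monoX g n : galg_mono F g ^+ n = galg_mono F (g *+ n).
Proof.
by elim: n => [|n IHn]; rewrite ?mulr0n // exprS IHn galg_monoD mulrS.
Qed.

Lemma galg_monoE g h : galg_mono F g h = (h == g)%:R.
Proof. by rewrite ffunE. Qed.

Lemma galg_mulmonoE g u h : (galg_mono F g * u) h = u (h - g).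
Proof.
rewrite galg_mulE (bigD1 g) //= galg_monoE eqxx mul1r big1 ?addr0 // => k.
by move=> /negPf kg; rewrite galg_monoE kg mul0r.
Qed.

Lemma galg_sumE (I : Type) (r : seq I) (P : pred I) (E : I -> FG) g :
  (\sum_(i <- r | P i) E i) g = \sum_(i <- r | P i) E i g.
Proof. by rewrite sum_ffunE. Qed.

End GroupAlgebraBasics.

Lemma exprn_sum_pchar (R : comNzRingType) (n : nat) (I : Type) (r : seq I)
    (P : pred I) (E : I -> R) : [pchar R].-nat n ->
  (\sum_(i <- r | P i) E i) ^+ n = \sum_(i <- r | P i) E i ^+ n.
Proof.
move=> nR; have n0 : (0 < n)%N by case/andP: nR.
apply: (big_morph (fun x => x ^+ n)) => [x y|]; first exact: exprDn_pchar.
by rewrite expr0n gtn_eqF.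
Qed.

Lemma exprB_pchar (R : comNzRingType) (n : nat) (x y : R) :
  [pchar R].-nat n -> (x - y) ^+ n = x ^+ n - y ^+ n.
Proof.
move=> nR; apply/eqP; rewrite eq_sym subr_eq; apply/eqP.
by rewrite -exprDn_pchar // subrK.
Qed.

Section Conjugation.
Variables (p nu : nat) (F : finFieldType) (G : finZmodType).
Hypotheses (p_pr : prime p) (cardF : #|F| = (p ^ (2 * nu))%N).
Local Notation FG := (group_algebra F G).
Local Notation q := (p ^ nu)%N.
Implicit Types (u v w : FG) (g h : G) (c : F).

Lemma cardFq : #|F| = (q * q)%N.
Proof. by rewrite cardF mul2n -addnn expnD. Qed.

Lemma pchar_galg : p \in [pchar FG].
Proof. by rewrite pchar_lalg; apply: card_finPcharP cardF p_pr. Qed.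

Lemma pcharX_galg k : [pchar FG].-nat (p ^ k)%N.
Proof. by rewrite pnatX (eq_pnat _ (pcharf_eq pchar_galg)) pnat_id. Qed.

Lemma pcharX_field k : [pchar F].-nat (p ^ k)%N.
Proof.
have pF := card_finPcharP cardF p_pr.
by rewrite pnatX (eq_pnat _ (pcharf_eq pF)) pnat_id.
Qed.

Lemma field_expX c t : c ^+ ((q * q) ^ t) = c.
Proof.
elim: t => [|t IHt]; first by rewrite expn0 expr1.
by rewrite expnS exprM -cardFq expf_card cardFq.
Qed.

Lemma q_gt0 : (0 < q)%N. Proof. by rewrite expn_gt0 prime_gt0. Qed.

Lemma qq_pow t : ((q * q) ^ t = p ^ (nu * 2 * t))%N.
Proof. by rewrite mulnn -!expnM mulnA. Qed.

Lemma galg_exp_pchar k u :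
  u ^+ (p ^ k) = \sum_g u g ^+ (p ^ k) *: galg_mono F (g *+ p ^ k).
Proof.
rewrite {1}(galg_sum_mono u) exprn_sum_pchar ?pcharX_galg //.
by apply: eq_bigr => g _; rewrite galg_exprZ galg_monoX.
Qed.

(** As [q * q] is the order of [F], this power fixes all coefficients: it is an F-linear map induced
    by a multiplication on [G]. *)
Lemma galg_exp_qq t u :
  u ^+ ((q * q) ^ t) = \sum_g u g *: galg_mono F (g *+ ((q * q) ^ t)).
Proof.
rewrite qq_pow galg_exp_pchar; apply: eq_bigr => g _.
by rewrite -!qq_pow field_expX.
Qed.

(** The involution for which the Hermitian form is the coefficient at 0 of [u * galg_conj v], see
    [hermitian_dotE]. *)
Definition galg_conj u : FG := [ffun g => u (- g) ^+ q].

Lemma galg_conjE u g : galg_conj u g = u (- g) ^+ q.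
Proof. by rewrite ffunE. Qed.

Lemma galg_conjK : involutive galg_conj.
Proof.
move=> u; apply/ffunP => g; rewrite !galg_conjE opprK -exprM.
by have := field_expX (u g) 1; rewrite expn1.
Qed.

Lemma galg_conjB : {morph galg_conj : u v / u - v}.
Proof.
move=> u v; apply/ffunP => g.
by rewrite galg_conjE !ffunE exprB_pchar ?pcharX_field // !galg_conjE.
Qed.

Lemma galg_conj_mono g : galg_conj (galg_mono F g) = galg_mono F (- g).
Proof.
apply/ffunP => h; rewrite galg_conjE !galg_monoE eqr_oppLR.
by case: eqP; rewrite ?expr1n // expr0n gtn_eqF ?q_gt0.
Qed.

Lemma galg_conj1 : galg_conj 1 = 1.
Proof. by rewrite -galg_mono0 galg_conj_mono oppr0. Qed.

Lemma galg_conjM : {morph galg_conj : u v / u * v}.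
Proof.
move=> u v; apply/ffunP => g; rewrite galg_conjE !galg_mulE.
rewrite exprn_sum_pchar ?pcharX_field // (reindex_inj oppr_inj) /=.
apply: eq_bigr => h _; rewrite exprMn !galg_conjE.
by rewrite opprK opprB addrC.
Qed.

Lemma galg_conj0 : galg_conj 0 = 0.
Proof. by rewrite -(subrr 0) galg_conjB !subrr. Qed.

Lemma galg_conjD : {morph galg_conj : u v / u + v}.
Proof.
move=> u v; apply/ffunP => g.
by rewrite galg_conjE !ffunE exprDn_pchar ?pcharX_field // !galg_conjE.
Qed.

Lemma galg_conjX u n : galg_conj (u ^+ n) = galg_conj u ^+ n.
Proof.
by elim: n => [|n IHn]; rewrite ?expr0 ?galg_conj1 // !exprS galg_conjM IHn.
Qed.

Lemma galg_conjZ c u : galg_conj (c *: u) = c ^+ q *: galg_conj u.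
Proof. by apply/ffunP => g; rewrite !ffunE exprMn. Qed.

Lemma hermitian_dotE u v : hermitian_dot p nu u v = (u * galg_conj v) 0.
Proof.
by rewrite galg_mulE; apply: eq_bigr => g _; rewrite galg_conjE sub0r opprK.
Qed.

(* An ideal is closed under translation by the monomials, so orthogonality in
   one coefficient upgrades to a vanishing product. *)
Lemma mem_hermitian_dual (C : {set FG}) v : is_ideal C ->
  reflect {in C, forall u, u * galg_conj v = 0} (v \in hermitian_dual p nu C).
Proof.
move=> /and3P[_ _ /forallP CM]; rewrite inE.
apply: (iffP forall_inP) => [Cv u Cu | Cv u Cu]; last first.
  by rewrite hermitian_dotE Cv // ffunE.
apply/ffunP => g; rewrite [RHS]ffunE.
have /forall_inP/(_ u Cu)/Cv/eqP := CM (galg_mono F (- g)).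
by rewrite hermitian_dotE -mulrA galg_mulmonoE opprK add0r.
Qed.

End Conjugation.

(** * Primitive idempotents and chain rings *)

Section PrimitiveIdempotents.
Variable R : finComNzRingType.
Implicit Types e f u : R.

Definition primitive_idem e : bool :=
  [&& e != 0, e * e == e &
    [forall f, (f * f == f) ==> (f * e == f) ==> (f == 0) || (f == e)]].

Lemma primitive_neq0 e : primitive_idem e -> e != 0.
Proof. by case/and3P. Qed.

Lemma primitive_id e : primitive_idem e -> e * e = e.
Proof. by case/and3P => _ /eqP. Qed.

Lemma primitive_min e f :
  primitive_idem e -> f * f = f -> f * e = f -> f != 0 -> f = e.
Proof.
case/and3P => _ _ /forallP/(_ f)/implyP e_min ff fe /negPf f0.
by move: (e_min (introT eqP ff)); rewrite fe eqxx f0 => /eqP.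
Qed.

(** [e * f] is an idempotent below both factors; if it is nonzero, minimality makes it equal to
    each. *)
Lemma primitive_orth e f :
  primitive_idem e -> primitive_idem f -> e != f -> e * f = 0.
Proof.
move=> eP fP; apply: contraNeq => ef0.
have ee := primitive_id eP; have ff := primitive_id fP.
have efef : e * f * (e * f) = e * f by rewrite mulrACA ee ff.
have <- : e * f = e by apply: primitive_min ef0; rewrite // mulrAC ee.
by apply/eqP; apply: primitive_min ef0; rewrite // -mulrA ff.
Qed.

(** Induction on the size of the ideal generated by [f]: an idempotent [g] strictly below [f]
    generates a smaller one, which misses [f]. *)
Lemma primitive_below f :
  f * f = f -> f != 0 -> exists2 e, primitive_idem e & e * f = e.
Proof.
have [n] := ubnP #|[set f * u | u : R]|; elim: n => // n IHn in f *.
rewrite ltnS => le_n ff f0; have [fP | ] := boolP (primitive_idem f).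
  by exists f.
rewrite /primitive_idem f0 ff eqxx /= => /forallPn[g].
rewrite !negb_imply negb_or => /and4P[/eqP gg /eqP gf g0 neq_gf].
have [||//|e eP eg] := IHn g; last first.
- by exists e; rewrite // -eg -mulrA gf.
- exact: gg.
apply: leq_trans le_n; apply/proper_card/properP; split.
  apply/subsetP => _ /imsetP[u _ ->]; apply/imsetP; exists (g * u) => //.
  by rewrite mulrA [f * g]mulrC gf.
exists f; first by apply/imsetP; exists f.
apply/imsetP => -[u _ fgu]; case/eqP: neq_gf.
by rewrite -gf fgu mulrA gg.
Qed.

Definition primitive_type : finType := {e : R | primitive_idem e}.

Lemma primitive_orthI (e f : primitive_type) :
  val e * val f = if e == f then val e else 0.
Proof.
case: eqP => [-> | /eqP neq]; first by rewrite (primitive_id (valP f)).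
by rewrite primitive_orth ?(valP e, valP f).
Qed.

Lemma primitive_sum_pred (P : pred primitive_type) (e : primitive_type) :
  val e * (\sum_(f | P f) val f) = if P e then val e else 0.
Proof.
rewrite big_distrr /= big_mkcond (bigD1 e) //= primitive_orthI eqxx.
rewrite big1 ?addr0 // => f; rewrite eq_sym => /negPf neq.
by rewrite primitive_orthI neq; case: ifP.
Qed.

(** The complement [1 - s] is idempotent, and every primitive idempotent is killed by it, so none
    lies below it. *)
Lemma primitive_sum1 : \sum_(e : primitive_type) val e = 1.
Proof.
set s := \sum_e val e; apply/eqP; rewrite eq_sym -subr_eq0.
have es (e : primitive_type) : val e * s = val e.
  exact: (primitive_sum_pred xpredT).
have ss : s * s = s by rewrite {1}/s big_distrl /=; apply: eq_bigr => e _;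
  exact: es.
apply: contraT => /primitive_below[|e eP].
  by rewrite mulrBr mulr1 mulrBl mul1r ss subrr subr0.
rewrite mulrBr mulr1 (es (Sub e eP)) subrr => e0.
by have := primitive_neq0 eP; rewrite -e0 eqxx.
Qed.

Lemma primitive_decomp u : u = \sum_(e : primitive_type) val e * u.
Proof. by rewrite -big_distrl /= primitive_sum1 mul1r. Qed.

(** Primitivity is expressed through products and 0, so a multiplicative involution transports it.
    Meant for [galg_conj]. *)
Lemma primitive_morph (theta : R -> R) : involutive theta -> theta 0 = 0 ->
  {morph theta : u v / u * v} ->
  forall e, primitive_idem e -> primitive_idem (theta e).
Proof.
move=> thetaK theta0 thetaM e eP; apply/and3P; split.
- by rewrite -theta0 (inj_eq (can_inj thetaK)) primitive_neq0.
- by rewrite -thetaM (primitive_id eP).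
apply/forallP => f; apply/implyP => /eqP ff; apply/implyP => /eqP fe.
have [-> // | f0 /=] := eqVneq f 0.
rewrite -(can_eq thetaK) thetaK; apply/eqP/primitive_min => //.
- by rewrite -thetaM ff.
- by rewrite -[e]thetaK -thetaM fe.
- by rewrite -theta0 (inj_eq (can_inj thetaK)).
Qed.

End PrimitiveIdempotents.

(** * Components of the group algebra as chain rings *)

Section ChainRing.
Variables (p nu k t : nat) (F : finFieldType) (G : finZmodType) (z : G).
Local Notation FG := (group_algebra F G).
Local Notation q := (p ^ nu)%N.
Local Notation N := (p ^ k)%N.
Local Notation Q := ((q * q) ^ t)%N.
Hypotheses (p_pr : prime p) (cardF : #|F| = (p ^ (2 * nu))%N).
Hypotheses (Q_gt1 : (1 < Q)%N) (mulQQ : forall g : G, g *+ Q *+ Q = g *+ Q).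
Hypothesis mulQ_sub : forall g : G, exists j, g = g *+ Q + z *+ j.
Hypotheses (zQ : z *+ Q = 0) (zN : z *+ N = 0).
Hypothesis z_order : forall j, (j < N)%N -> z *+ j = 0 -> j = 0%N.
Implicit Types (u v w e : FG) (g h : G) (c : F) (s : nat).

(** By the hypotheses, multiplication by [Q] is a projection of [G] whose kernel is generated by
    [z], of order [N]. *)
Definition aug_gen : FG := galg_mono F z - 1.
Local Notation x := aug_gen.

Lemma N_gt0 : (0 < N)%N. Proof. by rewrite expn_gt0 prime_gt0. Qed.

(** In characteristic [p], [x ^+ N] is the monomial of [z *+ N = 0] minus 1. *)
Lemma aug_genXN s : (N <= s)%N -> x ^+ s = 0.
Proof.
move=> /subnKC <-; rewrite exprD exprB_pchar; last exact: pcharX_galg cardF _.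
by rewrite galg_monoX zN expr1n subrr mul0r.
Qed.

Definition aug_div s u : bool := [exists w, u == x ^+ s * w].

Lemma aug_divP s u : reflect (exists w, u = x ^+ s * w) (aug_div s u).
Proof.
by apply: (iffP existsP) => -[w wP]; exists w; apply/eqP.
Qed.

Lemma aug_div_mulX s u : aug_div s (x ^+ s * u).
Proof. by apply/aug_divP; exists u. Qed.

Lemma aug_div0 u : aug_div 0 u.
Proof. by rewrite -[u]mul1r -(expr0 x) aug_div_mulX. Qed.

Lemma aug_div_0 s : aug_div s 0.
Proof. by rewrite -(mulr0 (x ^+ s)) aug_div_mulX. Qed.

Lemma aug_divD s u v : aug_div s u -> aug_div s v -> aug_div s (u + v).
Proof.
by move=> /aug_divP[w ->] /aug_divP[w' ->]; rewrite -mulrDr aug_div_mulX.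
Qed.

Lemma aug_divM s u v : aug_div s v -> aug_div s (u * v).
Proof. by move=> /aug_divP[w ->]; rewrite mulrCA aug_div_mulX. Qed.

Lemma aug_div_le s s' u : (s <= s')%N -> aug_div s' u -> aug_div s u.
Proof.
by move=> /subnKC <- /aug_divP[w ->]; rewrite exprD -mulrA aug_div_mulX.
Qed.

Lemma aug_div_eq0 s u : (N <= s)%N -> aug_div s u = (u == 0).
Proof.
move=> le_Ns; apply/idP/eqP => [/aug_divP[w ->] | ->]; last exact: aug_div_0.
by rewrite aug_genXN ?mul0r.
Qed.

(** By linearity only monomials matter. The monomials of [g] and [g *+ Q] differ by a multiple of
    the monomial of [z *+ j] minus 1, which a geometric sum divides by [x]. *)
Lemma aug_div_subQ u : aug_div 1 (u - u ^+ Q).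
Proof.
rewrite (galg_exp_qq p_pr cardF) {1}(galg_sum_mono u) -sumrB.
apply: (big_ind (aug_div 1)) => [||g _]; [exact: aug_div_0 | exact: aug_divD |].
rewrite -scalerBr -[galg_mono F g - _]mul1r scalerAl; apply: aug_divM.
have [j {1}->] := mulQ_sub g.
rewrite -galg_monoD -[X in _ - X]mulr1 -mulrBr; apply: aug_divM.
by rewrite -galg_monoX subrX1 -[X in X * _]expr1 aug_div_mulX.
Qed.

Lemma expQQ u : u ^+ Q ^+ Q = u ^+ Q.
Proof.
rewrite -exprM -expnD addnn -muln2; rewrite !(galg_exp_qq p_pr cardF).
by apply: eq_bigr => g _; rewrite muln2 -addnn expnD mulrnA mulQQ.
Qed.

Lemma idem_exp e n : e * e = e -> (0 < n)%N -> e ^+ n = e.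
Proof.
by move=> ee; case: n => // n _; elim: n => // n IHn; rewrite exprS IHn.
Qed.

Section Primitive.
Variable e : FG.
Hypothesis eP : primitive_idem e.

(** If [u ^+ Q = 0], then [u] is [u - u ^+ Q]. Otherwise [b = u ^+ Q] satisfies [b ^+ Q = b], so
    [b ^+ Q.-1] is a nonzero idempotent below [e], hence [e]. *)
Lemma primitive_dichotomy u : u * e = u ->
  (exists w, u * w = e) \/ aug_div 1 u.
Proof.
move=> ue; have [uQ0 | uQ0] := eqVneq (u ^+ Q) 0.
  by right; rewrite -[u]subr0 -uQ0 aug_div_subQ.
(* Chosen so that its product with [u] is [u ^+ Q ^+ Q.-1]. *)
left; exists (u ^+ Q.-1 * u ^+ Q ^+ Q.-2).
have Q2 : Q = Q.-2.+2 by case: (Q) Q_gt1 => [|[]].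
rewrite mulrA -exprS prednK ?(ltnW Q_gt1) //.
have -> : u ^+ Q * u ^+ Q ^+ Q.-2 = u ^+ Q ^+ Q.-1 by rewrite -exprS Q2.
set b := u ^+ Q in uQ0 *; have bQ : b ^+ Q = b by apply: expQQ.
have be : b * e = b.
  rewrite /b -{2}ue exprMn; congr (_ * _).
  by rewrite idem_exp ?(primitive_id eP) // ltnW.
have bb : b ^+ Q.-1 * b = b by rewrite -exprSr prednK // ltnW.
apply: primitive_min => //.
- rewrite -exprD; have -> : (Q.-1 + Q.-1 = Q + Q.-2)%N.
    by move: (Q) Q2 => n; lia.
  by rewrite exprD bQ -exprS Q2.
- by rewrite Q2 exprSr -mulrA be.
- by apply: contraNneq uQ0 => b0; rewrite -bb b0 mul0r.
Qed.

Lemma aug_genX_primitive s : (s < N)%N -> x ^+ s * e != 0.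
Proof.
move=> lt_sN; suff: x ^+ N.-1 * e != 0.
  apply: contraNneq => xse0; have le_sN : (s <= N.-1)%N by lia.
  by rewrite -(subnK le_sN) exprD -mulrA xse0 mulr0.
(* Since [e] is its own [Q]-th power, its support lies in the image of multiplication by [Q]. *)
have eQ h : e h != 0 -> h *+ Q = h.
  have -> : e = e ^+ Q by rewrite idem_exp ?(primitive_id eP) // ltnW.
  rewrite (galg_exp_qq p_pr cardF) galg_sumE => eh0; apply/eqP.
  apply: contraNT eh0 => hQ; rewrite big1 // => g _.
  rewrite galg_scaleE galg_monoE; case: eqP => [hg|]; last by rewrite mulr0.
  by rewrite hg mulQQ eqxx in hQ.
have [h eh0] : exists h, e h != 0.
  apply/existsP; apply: contraNT (primitive_neq0 eP) => /existsPn e0.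
  by apply/eqP/ffunP => h; rewrite ffunE; apply/eqP; rewrite -[_ == _]negbK e0.
have hQ := eQ h eh0; apply: contraNneq eh0 => xe0.
(* At this element only the leading binomial term of [x ^+ N.-1] contributes, and it contributes
   [e h]. *)
have := congr1 (fun u : FG => u (h + z *+ N.-1)) xe0.
rewrite exprBn big_distrl /= galg_sumE big_ord_recl /= big1 ?addr0.
  rewrite expr0 mul1r subn0 bin0 mulr1n mulr1 galg_monoX galg_mulmonoE addrK
    => ->.
  by rewrite ffunE.
move=> i _; rewrite expr1n mulr1 galg_monoX /= /bump leq0n add1n.
have : (i.+1 <= N.-1)%N by [].
move: (nat_of_ord i) => {i}i lt_i; set h' := h + _.
(* A contribution would put [h + z *+ i.+1] in the support of [e]; multiplication by [Q] sends that
   element to [h], so [z *+ i.+1 = 0] with [0 < i.+1 < N]. *)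
have Eh' : (galg_mono F (z *+ (N.-1 - i.+1)) * e : FG) h' = 0.
  rewrite galg_mulmonoE; apply/eqP; apply: contraT => /eQ.
  have -> : h' - z *+ (N.-1 - i.+1) = h + z *+ i.+1.
    by rewrite /h' -{1}(subnK lt_i) mulrnDr addrA addrAC addrK.
  rewrite mulrnDl hQ -mulrnA mulnC mulrnA zQ mul0rn addr0 => /eqP.
  rewrite -subr_eq0 opprD addNKr oppr_eq0 => /eqP/z_order.
  by move: (N) lt_i => n; lia.
rewrite -mulrnAl -signr_odd -mulrA.
case: odd; rewrite ?expr0 ?mul1r ?expr1 ?mulN1r.
all: rewrite ?(mulNr, mulrnAl, mulNrn, mul1r) ?ffunE ?ffunMnE ?Eh' ?(mul0rn,
  oppr0) //.
Qed.

(** For the largest [s <= N] such that [x ^+ s] divides [u], the cofactor is not divisible by [x]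
    when [s < N], so by the dichotomy it is invertible in the component. *)
Lemma primitive_chain u : u * e = u ->
  exists s, [/\ (s <= N)%N, aug_div s u & exists w, x ^+ s * e = u * w].
Proof.
move=> ue; pose P s := (s <= N)%N && aug_div s u.
have P0 : exists s, P s by exists 0%N; rewrite /P aug_div0.
have PN s : P s -> (s <= N)%N by case/andP.
case: (ex_maxnP P0 PN) => s /andP[le_sN us] s_max; exists s; split=> //.
have [eq_sN | neq_sN] := eqVneq s N.
  by exists 0; rewrite eq_sN aug_genXN // mul0r mulr0.
have /aug_divP[w uw] := us.
have uwe : u = x ^+ s * (w * e) by rewrite mulrA -uw ue.
have [|[w' ww'] | /aug_divP[w' ww']] := @primitive_dichotomy (w * e).
- by rewrite -mulrA (primitive_id eP).
- by exists w'; rewrite uwe -mulrA ww'.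
have /s_max : P s.+1; last by rewrite ltnn.
rewrite /P ltn_neqAle neq_sN le_sN; apply/aug_divP; exists w'.
by rewrite uwe ww' expr1 mulrA -exprSr.
Qed.

(** If [s' < s], multiplying by [x ^+ (N.-1 - s')] would give [x ^+ N.-1 * e = 0]. *)
Lemma aug_div_genX s s' : (s <= N)%N -> aug_div s (x ^+ s' * e) = (s <= s')%N.
Proof.
move=> le_sN; apply/idP/idP => [| le_ss']; last first.
  by rewrite mulrC; apply/aug_divM/(aug_div_le le_ss');
    rewrite -[x ^+ _]mulr1 aug_div_mulX.
move=> /aug_divP[w xw]; rewrite leqNgt; apply/negP => lt_s's.
have lt_N : (N.-1 < N)%N by rewrite prednK ?N_gt0.
have := aug_genX_primitive lt_N; have le_s'N : (s' <= N.-1)%N by lia.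
rewrite -(subnK le_s'N) exprD -mulrA xw mulrA -exprD aug_genXN ?mul0r ?eqxx //.
by lia.
Qed.

(** By [primitive_chain], [u] generates the same ideal as some [x ^+ s' * e], so being killed by
    [x ^+ s] forces [s + s' >= N]. This is the source of the exponents [N - s] of dual codes. *)
Lemma aug_annihilator s u : u * e = u -> (s <= N)%N ->
  (x ^+ s * u == 0) = aug_div (N - s) u.
Proof.
move=> ue le_sN; apply/idP/idP => [/eqP xu0 | /aug_divP[w ->]]; last first.
  by rewrite mulrA -exprD subnKC // aug_genXN ?mul0r.
have [s' [le_s'N us' [w xw]]] := primitive_chain ue.
apply: aug_div_le us'; rewrite leq_subLR leqNgt;
  apply/negP => /aug_genX_primitive.
by rewrite exprD -mulrA xw mulrA xu0 mul0r eqxx.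
Qed.

End Primitive.
End ChainRing.

(** * Ideals and their hulls *)

Section IdealDimension.
Variables (F : finFieldType) (G : finZmodType).
Local Notation FG := (group_algebra F G).

Lemma ideal_span (C : {set FG}) : is_ideal C -> <<enum C>>%VS =i C.
Proof.
move=> /and3P[C0 /forall_inP CD /forallP CM] x.
apply/idP/idP => [xC | xC]; last by rewrite memv_span ?mem_enum.
rewrite (coord_span xC); apply: (big_ind (fun y => y \in C)) => [//|u v Cu
  Cv|i _].
  by have /forall_inP -> := CD u Cu.
set u := _`_i; set a := coord _ _ _; rewrite -[u]mul1r scalerAl.
have /forall_inP -> // := CM (a *: 1).
by rewrite -mem_enum; apply: mem_nth; rewrite -cardE.
Qed.

Lemma card_ideal (C : {set FG}) : is_ideal C -> #|C| = (#|F| ^ code_dim C)%N.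
Proof.
by move=> /ideal_span CE; rewrite -card_vspace; apply: eq_card => u; rewrite CE.
Qed.

Lemma card_galg : #|{: FG}| = (#|F| ^ #|G|)%N.
Proof. by rewrite card_ffun. Qed.

End IdealDimension.

Section Codes.
Variables (p nu k t : nat) (F : finFieldType) (G : finZmodType) (z : G).
Local Notation FG := (group_algebra F G).
Local Notation q := (p ^ nu)%N.
Local Notation N := (p ^ k)%N.
Local Notation Q := ((q * q) ^ t)%N.
Hypotheses (p_pr : prime p) (cardF : #|F| = (p ^ (2 * nu))%N).
Hypotheses (Q_gt1 : (1 < Q)%N) (mulQQ : forall g : G, g *+ Q *+ Q = g *+ Q).
Hypothesis mulQ_sub : forall g : G, exists j, g = g *+ Q + z *+ j.
Hypotheses (zQ : z *+ Q = 0) (zN : z *+ N = 0).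
Hypothesis z_order : forall j, (j < N)%N -> z *+ j = 0 -> j = 0%N.
Local Notation x := (aug_gen F z).
Local Notation aug_div := (@aug_div F G z).
Local Notation I := (primitive_type FG).
Local Notation conj := (@galg_conj p nu F G).
Implicit Types (u v w : FG) (e f : I) (s : {ffun I -> 'I_N.+1}).

Let genXN := aug_genXN p_pr cardF zN.
Let annihilator :=
  aug_annihilator p_pr cardF Q_gt1 mulQQ mulQ_sub zQ zN z_order.
Let chain := primitive_chain p_pr cardF Q_gt1 mulQQ mulQ_sub zN.
Let div_genX := aug_div_genX p_pr cardF Q_gt1 mulQQ zQ zN z_order.

(** [insubd] returns to the subtype; [conj_primitiveE] shows that the conjugate is indeed
    primitive. *)
Definition conj_primitive e : I := insubd e (conj (val e)).

Lemma conj_primitiveE e : val (conj_primitive e) = conj (val e).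
Proof.
rewrite val_insubd (primitive_morph _ _ _ (valP e)) //.
- exact: galg_conjK cardF.
- exact: galg_conj0 p_pr cardF.
- exact: galg_conjM p_pr cardF.
Qed.

Lemma conj_primitiveK : involutive conj_primitive.
Proof. by move=> e; apply: val_inj; rewrite !conj_primitiveE (galg_conjK
  cardF). Qed.

Definition code_of s : {set FG} :=
  [set u | [forall e : I, aug_div (s e) (val e * u)]].

Lemma code_ofP s u :
  reflect (forall e, aug_div (s e) (val e * u)) (u \in code_of s).
Proof. by rewrite inE; apply: forallP. Qed.

Lemma code_of_ideal s : is_ideal (code_of s).
Proof.
apply/and3P; split.
- by apply/code_ofP => e; rewrite mulr0 aug_div_0.
- apply/forall_inP => u /code_ofP us; apply/forall_inP => v /code_ofP vs.
  by apply/code_ofP => e; rewrite mulrDr aug_divD.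
apply/forallP => a; apply/forall_inP => u /code_ofP us.
by apply/code_ofP => e; rewrite mulrCA aug_divM.
Qed.

(** Recovers the exponents from the code; injectivity of [code_of] follows. *)
Lemma mem_code_of_gen s n e : (x ^+ n * val e \in code_of s) = (s e <= n)%N.
Proof.
have le_sN f : (s f <= N)%N by rewrite -ltnS.
apply/code_ofP/idP => [/(_ e) | le_sn f].
  by rewrite mulrCA primitive_orthI eqxx div_genX ?(valP e).
rewrite mulrCA primitive_orthI; case: eqP => [-> | _].
  by rewrite div_genX ?(valP e).
by rewrite mulr0 aug_div_0.
Qed.

Lemma code_of_inj : injective code_of.
Proof.
move=> s s' eq_ss'; apply/ffunP => e; apply/val_inj/eqP; rewrite eqn_leq.
by rewrite -mem_code_of_gen eq_ss' mem_code_of_gen leqnn /= -mem_code_of_gen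
  -eq_ss' mem_code_of_gen leqnn.
Qed.

(** The exponent at [e] is the least [i] with [x ^+ i * val e] in [C]; by [primitive_chain] these
    generators determine [C]. *)
Lemma code_of_surj (C : {set FG}) : is_ideal C -> exists s, C = code_of s.
Proof.
move=> /and3P[C0 /forall_inP CD /forallP CMb].
have CM a u : u \in C -> a * u \in C by move: u; apply/forall_inP.
(* [ord_max] is the exponent [N], where the generator is 0; so the minimum below is taken over a
   nonempty set. *)
have CN e : x ^+ (ord_max : 'I_N.+1) * val e \in C by rewrite genXN ?mul0r.
pose s := [ffun e : I => [arg min_(i < (ord_max : 'I_N.+1) | x ^+ i * val e
  \in C) i]].
have sC e : x ^+ (s e) * val e \in C.
  by rewrite ffunE; case: arg_minnP.
have s_min e n : (n <= N)%N -> x ^+ n * val e \in C -> (s e <= n)%N.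
  rewrite -ltnS => lt_nN; rewrite ffunE; case: arg_minnP => // i _ i_min.
  exact: (i_min (Ordinal lt_nN)).
exists s; apply/setP => u; apply/idP/code_ofP => [Cu e | us].
  have [|n [le_nN nu_ [w xw]]] := chain (valP e) (u := val e * u).
    by rewrite mulrC mulrA (primitive_id (valP e)).
  by apply: aug_div_le nu_; apply: s_min; rewrite // xw mulrC; apply/CM/CM.
rewrite (primitive_decomp u); apply: (big_ind (fun y => y \in C)) => [//|v w
  Cv Cw|e _].
  by have /forall_inP -> := CD v Cv.
have /aug_divP[w ew] := us e.
rewrite -(primitive_id (valP e)) -mulrA ew mulrA mulrC.
by rewrite [_ * x ^+ _]mulrC; apply: CM.
Qed.

Lemma abelian_codesE : abelian_codes F G = [set code_of s | s : {ffun I ->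
  'I_N.+1}].
Proof.
apply/setP => C; rewrite inE; apply/idP/imsetP => [/code_of_surj[s ->] | [s _
  ->]].
  by exists s.
exact: code_of_ideal.
Qed.

Lemma card_abelian_codes : #|abelian_codes F G| = (N.+1 ^ #|{: I}|)%N.
Proof.
by rewrite abelian_codesE card_imset ?card_ffun ?card_ord //;
  apply: code_of_inj.
Qed.

Lemma conj_aug_gen : conj x = - (galg_mono F (- z) * x).
Proof.
rewrite /aug_gen (galg_conjB p_pr cardF) galg_conj1 //.
rewrite galg_conj_mono // mulrBr mulr1 galg_monoD addNr opprB.
by rewrite galg_mono0.
Qed.

(** Conjugation multiplies [x] by a unit, namely minus a monomial. *)
Lemma conj_aug_genX_eq0 n u : (conj (x ^+ n) * u == 0) = (x ^+ n * u == 0).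
Proof.
apply/eqP/eqP => [xu0 | xu0]; rewrite galg_conjX // in xu0 *.
  have xE : x = - galg_mono F z * conj x.
    rewrite conj_aug_gen mulrNN mulrA galg_monoD addrN galg_mono0.
    by rewrite mul1r.
  by rewrite xE exprMn -mulrA xu0 mulr0.
by rewrite conj_aug_gen -mulNr exprMn -mulrA xu0 mulr0.
Qed.

Definition hull_exp s : {ffun I -> 'I_N.+1} :=
  [ffun e => inord (maxn (s e) (N - s (conj_primitive e)))].

Lemma hull_expE s e :
  hull_exp s e = maxn (s e) (N - s (conj_primitive e)) :> nat.
Proof. by rewrite ffunE inordK // ltnS geq_max leq_subr -ltnS ltn_ord. Qed.

(** Pairing with the generator of the code at the conjugate of [e] says, after conjugation, that a
    power of [x] kills [val e * v]; [aug_annihilator] turns this into divisibility. *)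
Lemma mem_dual_code_of s v :
  (v \in hermitian_dual p nu (code_of s)) =
  [forall e : I, aug_div (N - s (conj_primitive e)) (val e * v)].
Proof.
have le_sN f : (s f <= N)%N by rewrite -ltnS.
have ann e n : (n <= N)%N ->
    (x ^+ n * (val e * v) == 0) = aug_div (N - n) (val e * v).
  by move=> le_nN; rewrite (annihilator (valP e)) // mulrC mulrA (primitive_id
    (valP e)).
apply/(mem_hermitian_dual p nu v (code_of_ideal s))/forallP => [sv e | sv u].
  rewrite -ann // -conj_aug_genX_eq0; apply/eqP.
  apply: (can_inj (galg_conjK cardF)); rewrite galg_conjM // (galg_conjK cardF).
  rewrite galg_conj0 // galg_conjM // -conj_primitiveE mulrA.
  by rewrite sv // mem_code_of_gen.
move=> /code_ofP us; apply: (can_inj (galg_conjK cardF)).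
rewrite galg_conjM // galg_conj0 // galg_conjK //.
rewrite (primitive_decomp (conj u * v)) big1 // => e _.
rewrite -(primitive_id (valP e)) mulrACA -{1}[val e](galg_conjK cardF).
rewrite -conj_primitiveE -galg_conjM //.
have /aug_divP[w ->] := us (conj_primitive e).
rewrite galg_conjM // mulrAC.
have /eqP -> : conj (x ^+ s (conj_primitive e)) * (val e * v) == 0.
  by rewrite conj_aug_genX_eq0 ann.
by rewrite mul0r.
Qed.

Lemma hull_code_of s : hermitian_hull p nu (code_of s) = code_of (hull_exp s).
Proof.
apply/setP => v; rewrite inE mem_dual_code_of; apply/andP/code_ofP.
  move=> [/code_ofP sv /forallP dv] e; rewrite hull_expE.
  by rewrite /maxn; case: ifP.
move=> hv; split; [apply/code_ofP | apply/forallP] => e.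
all: by apply: aug_div_le (hv e); rewrite hull_expE leq_max leqnn ?orbT.
Qed.

Definition primitive_code e n : {set FG} :=
  [set u | (val e * u == u) && aug_div n u].

Lemma primitive_code_ideal e n : is_ideal (primitive_code e n).
Proof.
apply/and3P; split; first by rewrite inE mulr0 eqxx aug_div_0.
- apply/forall_inP => u; rewrite inE => /andP[/eqP eu nu_].
  apply/forall_inP => v; rewrite inE => /andP[/eqP ev nv].
  by rewrite inE mulrDr eu ev eqxx aug_divD.
apply/forallP => a; apply/forall_inP => u; rewrite inE => /andP[/eqP eu nu_].
by rewrite inE mulrCA eu eqxx aug_divM.
Qed.

(** The family of components [val e * u] determines [u], and summing recovers it from any compatible
    family. *)
Lemma card_code_of s : #|code_of s| = (\prod_e #|primitive_code e (s e)|)%N.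
Proof.
transitivity #|family (fun e : I => mem (primitive_code e (s e)))|; last first.
  by rewrite card_family foldrE big_map enumT.
pose split_u (u : FG) := [ffun e : I => val e * u].
have split_inj : injective split_u.
  move=> u v /ffunP uv; rewrite (primitive_decomp u) (primitive_decomp v).
  by apply: eq_bigr => e _; have := uv e; rewrite !ffunE.
rewrite -(card_imset _ split_inj); apply: eq_card => h.
apply/imsetP/familyP => [[u /code_ofP us ->] e | hs].
  by rewrite !inE ffunE us mulrA (primitive_id (valP e)) eqxx.
have eh e f : val e * h f = if e == f then h f else 0.
  have := hs f; rewrite !inE => /andP[/eqP <- _].
  by rewrite mulrA primitive_orthI; case: ifP; rewrite ?mul0r // => /eqP->.
have es e : val e * (\sum_f h f) = h e.
  rewrite big_distrr /= (bigD1 e) //= eh eqxx big1 ?addr0 // => f.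
  by rewrite eq_sym => /negPf neq; rewrite eh neq.
exists (\sum_f h f); last by apply/ffunP => e; rewrite ffunE es.
by apply/code_ofP => e; rewrite es; have := hs e; rewrite !inE => /andP[].
Qed.

(** Multiplication by [x] maps level [n] onto level [n.+1]. Its kernel is level [N.-1], by
    [aug_annihilator] with exponent 1, and its fibres are cosets of that kernel. *)
Lemma card_primitive_codeS e n : (n < N)%N ->
  #|primitive_code e n| = (#|primitive_code e n.+1| * #|primitive_code e
    N.-1|)%N.
Proof.
move=> lt_nN; have N0 := N_gt0 k p_pr.
have xS u : u \in primitive_code e n -> x * u \in primitive_code e n.+1.
  rewrite !inE => /andP[/eqP eu /aug_divP[w uw]].
  by rewrite mulrCA eu eqxx uw mulrA -exprS aug_div_mulX.
rewrite -sum1_card (partition_big (fun u => x * u) (mem (primitive_code e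
  n.+1))) //.
rewrite -sum_nat_const; apply: eq_bigr => v; rewrite !inE => /andP[/eqP ev].
(* A preimage of [v], taken inside the component of [e]; it is the base point of the fibre. *)
move=> /aug_divP[w vw]; pose u0 := x ^+ n * (val e * w).
have xu0 : x * u0 = v by rewrite mulrA -exprS mulrCA -vw.
have u0n : u0 \in primitive_code e n.
  by rewrite inE aug_div_mulX /u0 mulrCA
    [val e * (_ * w)]mulrA (primitive_id (valP e)) eqxx.
rewrite sum1dep_card -[RHS](card_imset _ (addrI u0)); apply: eq_card => u.
rewrite [LHS]inE; apply/andP/imsetP => [[un /eqP xu] | [d]]; last first.
  rewrite inE => /andP[/eqP ed dN] ->; split; last first.
    rewrite mulrDr xu0 -subr_eq0 addrAC subrr add0r -[X in X * d]expr1.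
    by rewrite (annihilator (valP e)) ?subn1 // mulrC.
  have /and3P[_ /forall_inP/(_ _ u0n)/forall_inP -> //] :=
    primitive_code_ideal e n.
  by rewrite inE ed eqxx; apply: aug_div_le dN; lia.
exists (u - u0); last by rewrite addrC subrK.
have ed : val e * (u - u0) = u - u0.
  by move: un u0n; rewrite !inE mulrBr => /andP[/eqP-> _] /andP[/eqP-> _].
rewrite inE ed eqxx /= -subn1 -(annihilator (valP e)) ?expr1 //.
  by rewrite mulrBr xu xu0 subrr.
by rewrite mulrC.
Qed.

Lemma card_primitive_code e n : (n <= N)%N ->
  #|primitive_code e n| = (#|primitive_code e N.-1| ^ (N - n))%N.
Proof.
move=> le_nN; rewrite -{1}(subKn le_nN); elim: (N - n)%N (leq_subr n N) => [|d
  IHd] lt_dN.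
  rewrite subn0 expn0; apply/eqP/cards1P; exists 0; apply/setP => u.
  rewrite !inE (aug_div_eq0 p_pr cardF zN) //.
  by have [->|_] := eqVneq u 0; rewrite ?mulr0 ?eqxx ?andbF.
rewrite card_primitive_codeS; last by lia.
by rewrite expnSr -subSn // subSS IHd // ltnW.
Qed.

(** The number d_e: the dimension of the last nonzero level, which all successive quotients of the
    chain share. *)
Definition residue_dim e : nat := code_dim (primitive_code e N.-1).

Lemma code_dim_code_of s :
  code_dim (code_of s) = (\sum_e residue_dim e * (N - s e))%N.
Proof.
apply/eqP; rewrite -(eqn_exp2l _ _ (finNzRing_gt1 F)); apply/eqP.
rewrite -card_ideal ?code_of_ideal // card_code_of expn_sum.
apply: eq_bigr => e _; rewrite card_primitive_code; last by rewrite -ltnS.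
by rewrite card_ideal ?primitive_code_ideal // expnM.
Qed.

(** The exponent function 0 yields the whole algebra. *)
Lemma sum_residue_dim : (\sum_e residue_dim e * N = #|G|)%N.
Proof.
apply/eqP; rewrite -(eqn_exp2l _ _ (finNzRing_gt1 F)) -card_galg; apply/eqP.
transitivity #|code_of [ffun=> ord0]|.
  rewrite card_ideal ?code_of_ideal // code_dim_code_of; congr (_ ^ _)%N.
  by apply: eq_bigr => e _; rewrite ffunE subn0.
by apply: eq_card => u; apply/code_ofP => e; rewrite ffunE aug_div0.
Qed.

Lemma sum_dim_hull :
  (\sum_(C in abelian_codes F G) code_dim (hermitian_hull p nu C) =
   \sum_e residue_dim e * \sum_(s : {ffun I -> 'I_N.+1})
     minn (N - s e) (s (conj_primitive e)))%N.
Proof.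
rewrite abelian_codesE big_imset /=; last by move=> s s' _ _;
  apply: code_of_inj.
under eq_bigr => s _ do rewrite hull_code_of code_dim_code_of.
rewrite exchange_big /=; apply: eq_bigr => e _; rewrite big_distrr /=.
apply: eq_bigr => s _; rewrite hull_expE; congr (_ * _)%N.
have := ltn_ord (s e); have := ltn_ord (s (conj_primitive e)).
by move: (N) (s e : nat) (s (conj_primitive e) : nat) => n a b; lia.
Qed.

End Codes.

(** * Averages over the ideals *)

Section Averages.
Variables (I : finType) (n : nat).
Local Notation S := {ffun I -> 'I_n.+1}.

(* The independence of the coordinates is obtained by averaging over the
   translations of the additive group {ffun I -> 'I_n.+1}. *)
Lemma sum_ffun_coord (f : 'I_n.+1 -> nat) i :
  (n.+1 * \sum_(s : S) f (s i) = n.+1 ^ #|I| * \sum_a f a)%N.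
Proof.
have -> : (n.+1 ^ #|I| = #|{: S}|)%N by rewrite card_ffun card_ord.
rewrite -[RHS]sum_nat_const.
transitivity (\sum_(a : 'I_n.+1) \sum_(s : S) f (s i))%N.
  by rewrite sum_nat_const card_ord.
transitivity (\sum_(a : 'I_n.+1) \sum_(s : S) f (s i + a)%R)%N.
  apply: eq_bigr => a _; rewrite (reindex_inj (addIr [ffun=> a])) /=.
  by apply: eq_bigr => s _; rewrite !ffunE.
rewrite exchange_big /=; apply: eq_bigr => s _.
by rewrite [RHS](reindex_inj (addrI (s i))).
Qed.

Lemma sum_ffun_coord2 (f : 'I_n.+1 -> 'I_n.+1 -> nat) i j : i != j ->
  (n.+1 ^ 2 * \sum_(s : S) f (s i) (s j) =
   n.+1 ^ #|I| * \sum_a \sum_b f a b)%N.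
Proof.
move=> neq_ij; have -> : (n.+1 ^ #|I| = #|{: S}|)%N by rewrite card_ffun
  card_ord.
rewrite -[RHS]sum_nat_const.
transitivity (\sum_(a : 'I_n.+1) \sum_(b : 'I_n.+1) \sum_(s : S)
    f (s i) (s j))%N.
  by rewrite !sum_nat_const card_ord mulnA.
transitivity (\sum_(a : 'I_n.+1) \sum_(b : 'I_n.+1) \sum_(s : S)
    f (s i + a)%R (s j + b)%R)%N.
  apply: eq_bigr => a _; apply: eq_bigr => b _.
  (* Translation by [d] shifts coordinate [i] by [a] and coordinate [j], which differs from [i], by
     [b]. *)
  pose d : S := [ffun l => if l == i then a else b].
  rewrite (reindex_inj (addIr d)) /=.
  by apply: eq_bigr => s _; rewrite !ffunE eqxx eq_sym (negPf neq_ij).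
transitivity (\sum_(s : S) \sum_(a : 'I_n.+1) \sum_(b : 'I_n.+1)
    f (s i + a)%R (s j + b)%R)%N.
  rewrite [RHS]exchange_big; apply: eq_bigr => a _.
  by rewrite [RHS]exchange_big.
apply: eq_bigr => s _.
rewrite [RHS](reindex_inj (addrI (s i))) /=; apply: eq_bigr => a _.
by rewrite [RHS](reindex_inj (addrI (s j))).
Qed.

End Averages.

(** * Sums of minima and their strict bounds *)

Definition min_sum1 n := (\sum_(a < n.+1) minn (n - a) a)%N.
(** This is n(n+1)(2n+1)/6, while [min_sum1 n] is the floor of n^2/4. *)
Definition min_sum2 n := (\sum_(a < n.+1) \sum_(b < n.+1) minn (n - a) b)%N.

(** The two end terms vanish, and each of the [n.+1] inner ones exceeds a term of [min_sum1 n] by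
    1. *)
Lemma min_sum1S n : min_sum1 n.+2 = (min_sum1 n + n.+1)%N.
Proof.
rewrite /min_sum1 big_ord_recl big_ord_recr /= minn0 add0n.
rewrite /bump leq0n add1n subnn min0n addn0.
transitivity (\sum_(a < n.+1) (minn (n - a) a + 1))%N; last first.
  by rewrite big_split /= sum_nat_const card_ord muln1.
by apply: eq_bigr => i _; have := ltn_ord i; rewrite /bump leq0n; lia.
Qed.

Lemma min_sum1_lt n : (0 < n)%N -> (3 * min_sum1 n < n * n.+1)%N.
Proof.
(* The recursion advances by two, so consecutive values are carried together; the guard excludes
   [n = 0], where the bound fails. *)
suff H : (n.+1 * n > 0 -> 3 * min_sum1 n < n * n.+1)%N /\
    (3 * min_sum1 n.+1 < n.+1 * n.+2)%N by case: n H => // n [H _] _; apply: H.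
elim: n => [|n [IH1 IH2]].
  by rewrite /min_sum1 !big_ord_recl !big_ord0.
split=> [_|]; first exact: IH2.
rewrite min_sum1S; case: n IH1 {IH2} => [_|n IH1]; last by have := IH1 isT; nia.
by rewrite /min_sum1 big_ord1.
Qed.

Lemma min_sum2E n : min_sum2 n = (\sum_(a < n.+1) \sum_(b < n.+1) minn a b)%N.
Proof.
rewrite /min_sum2 (reindex_inj rev_ord_inj) /=.
apply: eq_bigr => a _; apply: eq_bigr => b _.
by rewrite subSS subKn // -ltnS.
Qed.

(** In the table of [minn a b], the new row and the new column each add 0 + ... + n, and the corner
    adds [n.+1]. *)
Lemma min_sum2S n : min_sum2 n.+1 = (min_sum2 n + n.+1 ^ 2)%N.
Proof.
rewrite !min_sum2E [LHS]big_ord_recr /=.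
under eq_bigr => a _.
  rewrite big_ord_recr /= (minn_idPl _); last by rewrite ltnW.
  over.
rewrite big_split /= -addnA; congr (_ + _)%N.
under [X in (_ + X)%N]eq_bigr => b _.
  rewrite (minn_idPr _); last by rewrite -ltnS.
  over.
rewrite [X in (_ + X)%N]big_ord_recr /= addnA -big_split /=.
under eq_bigr => a _ do rewrite addnn -muln2.
rewrite -(big_mkord xpredT (fun a => a * 2)%N).
have -> : (\sum_(0 <= a < n.+1) a * 2 = n.+1 * n)%N.
  elim: (n) => [|m IHm]; first by rewrite big_nat1.
  by rewrite big_nat_recr //= IHm; lia.
lia.
Qed.

Lemma min_sum2_lt n : (0 < n)%N -> (3 * min_sum2 n < n * n.+1 ^ 2)%N.
Proof.
case: n => // n _; elim: n => [|n IHn]; last by rewrite min_sum2S; nia.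
by rewrite min_sum2S /min_sum2 !big_ord_recl !big_ord0.
Qed.

(** * The average hull dimension as a sum over components *)

Section AverageHull.
Variables (p nu k t : nat) (F : finFieldType) (G : finZmodType) (z : G).
Local Notation FG := (group_algebra F G).
Local Notation q := (p ^ nu)%N.
Local Notation N := (p ^ k)%N.
Local Notation Q := ((q * q) ^ t)%N.
Hypotheses (p_pr : prime p) (cardF : #|F| = (p ^ (2 * nu))%N).
Hypotheses (Q_gt1 : (1 < Q)%N) (mulQQ : forall g : G, g *+ Q *+ Q = g *+ Q).
Hypothesis mulQ_sub : forall g : G, exists j, g = g *+ Q + z *+ j.
Hypotheses (zQ : z *+ Q = 0) (zN : z *+ N = 0).
Hypothesis z_order : forall j, (j < N)%N -> z *+ j = 0 -> j = 0%N.
Local Notation I := (primitive_type FG).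
Local Notation conjI := (@conj_primitive p nu F G).
Local Notation dimI := (@residue_dim p k F G z).

(** For a self-conjugate [e] the minimum involves one coordinate of [s], otherwise two independent
    ones. *)
Lemma avg_hullE : avg_hermitian_hull p nu F G =
  \sum_(e : I) (dimI e)%:R *
    (if conjI e == e then (min_sum1 N)%:R / N.+1%:R
     else (min_sum2 N)%:R / (N.+1 ^ 2)%:R).
Proof.
rewrite /avg_hermitian_hull.
rewrite (sum_dim_hull p_pr cardF Q_gt1 mulQQ mulQ_sub zQ zN z_order).
rewrite (card_abelian_codes p_pr cardF Q_gt1 mulQQ mulQ_sub zQ zN z_order).
rewrite natr_sum big_distrl /=; apply: eq_bigr => e _.
rewrite natrM -mulrA; congr (_ * _).
have S0 : (N.+1 ^ #|{: I}|)%:R != 0 :> rat by rewrite pnatr_eq0 expn_eq0.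
have N0 : N.+1%:R != 0 :> rat by rewrite pnatr_eq0.
have N20 : (N.+1 ^ 2)%:R != 0 :> rat by rewrite pnatr_eq0 expn_eq0.
have [-> | neq] := eqVneq (conjI e) e; apply/eqP.
  rewrite eqr_div // -!natrM; apply/eqP; congr (_%:R).
  by rewrite mulnC (sum_ffun_coord (fun a => minn (N - a) a)%N) mulnC.
rewrite eqr_div // -!natrM; apply/eqP; congr (_%:R).
rewrite mulnC (sum_ffun_coord2 (fun a b => minn (N - a) b)%N) 1?mulnC //.
by rewrite eq_sym.
Qed.

(** Both possible factors of d_e are below N/3, and the d_e times [N] add up to the positive number
    [#|G|]. *)
Lemma avg_hull_lt : avg_hermitian_hull p nu F G < #|G|%:R / 3.
Proof.
have G0 : (0 < #|G|)%N by apply/card_gt0P; exists 0.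
rewrite avg_hullE.
rewrite -(sum_residue_dim p_pr cardF Q_gt1 mulQQ mulQ_sub zQ zN z_order) in G0
  *.
have N0 := N_gt0 k p_pr.
have N1_gt0 : 0 < N.+1%:R :> rat by rewrite ltr0n.
have lt1 : (min_sum1 N)%:R / N.+1%:R < N%:R / 3 :> rat.
  rewrite ltr_pdivrMr // mulrAC ltr_pdivlMr // -!natrM ltr_nat mulnC.
  exact: min_sum1_lt.
have lt2 : (min_sum2 N)%:R / (N.+1 ^ 2)%:R < N%:R / 3 :> rat.
  rewrite ltr_pdivrMr ?ltr0n ?expn_gt0 // mulrAC ltr_pdivlMr // -!natrM ltr_nat.
  by rewrite mulnC; apply: min_sum2_lt.
set c1 := _ / N.+1%:R in lt1 *; set c2 := _ / (N.+1 ^ 2)%:R in lt2 *.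
set d := (\sum_e dimI e * N)%N in G0 *.
have dE : d%:R = (\sum_e dimI e)%:R * N%:R :> rat.
  by rewrite -natrM /d big_distrl.
have d0 : 0 < (\sum_e dimI e)%:R :> rat.
  by move: G0; rewrite -(ltr0n rat) dE pmulr_lgt0 ?ltr0n.
rewrite dE -mulrA; apply: le_lt_trans (_ : (\sum_e dimI e)%:R * Num.max c1 c2
  < _).
  rewrite natr_sum big_distrl /=; apply: ler_sum => e _.
  by apply: ler_wpM2l; rewrite ?ler0n // le_max; case: ifP; rewrite lexx ?orbT.
by rewrite ltr_pM2l // gt_max lt1.
Qed.
End AverageHull.

(** * Self-conjugate components in the semisimple case *)

Section OddPeriods.
Variables (X : finType) (f : X -> X).
Hypothesis f_inj : injective f.

(** Cancelling one [f] leaves the odd exponent 2i - 1; for [i = 0] the period is 1. *)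
Lemma odd_period i x : f x = iter i.*2 f x -> exists2 l, odd l & iter l f x = x.
Proof.
case: i => [|i]; first by exists 1%N.
rewrite doubleS => /f_inj fx; by exists i.*2.+1; rewrite /= ?odd_double.
Qed.

Lemma iter_mul_period m l x : iter l f x = x -> iter (m * l) f x = x.
Proof. by move=> fx; elim: m => // m IHm; rewrite mulSn iterD IHm. Qed.

Lemma common_odd_period (S : {pred X}) :
  {in S, forall x, exists2 l, odd l & iter l f x = x} ->
  exists2 m, odd m & {in S, forall x, iter m f x = x}.
Proof.
move=> Sodd.
have /fin_all_exists2[l l_odd fl] x :
    exists2 l, odd l & x \in S -> iter l f x = x.
  have [/Sodd[l l_odd fl]|_] := boolP (x \in S); last by exists 1%N.
  by exists l.
exists (\prod_x l x)%N.
  by apply: (big_ind odd) => // a b a_odd b_odd; rewrite oddM a_odd.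
move=> x Sx; rewrite (bigD1 x) //= mulnC; exact/iter_mul_period/fl.
Qed.

End OddPeriods.

(* Both fixed-point spaces split along V = V0 + V1 + V2, where V0 is fixed
   pointwise and P swaps V1 and V2: a fixed point of P is determined by its
   components in V0 and V1. *)
Lemma card_swap (V : finZmodType) (P p0 p1 p2 : V -> V) :
  {morph P : u v / u + v} ->
  {morph p0 : u v / u + v} -> {morph p1 : u v / u + v} ->
  {morph p2 : u v / u + v} ->
  (forall u, p0 u + p1 u + p2 u = u) ->
  (forall u, [/\ p0 (p0 u) = p0 u, p1 (p0 u) = 0 & p2 (p0 u) = 0]) ->
  (forall u, [/\ p0 (p1 u) = 0, p1 (p1 u) = p1 u & p2 (p1 u) = 0]) ->
  (forall u, [/\ p0 (p2 u) = 0, p1 (p2 u) = 0 & p2 (p2 u) = p2 u]) ->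
  (forall u, P (p0 u) = p0 u) -> (forall u, P (p1 u) = p2 (P u)) ->
  (forall u, P (p2 u) = p1 (P u)) ->
  (#|[set u | p0 u == u]| * #|[set u | P (P u) == u]| =
   #|[set u | P u == u]| ^ 2)%N.
Proof.
move=> PD p0D p1D p2D psum pp0 pp1 pp2 Pp0 Pp1 Pp2.
have p0P u : p0 (P u) = p0 u.
  rewrite -{1}(psum u) !PD Pp0 Pp1 Pp2 !p0D.
  by have [-> _ _] := pp0 u; have [-> _ _] := pp1 (P u);
     have [-> _ _] := pp2 (P u); rewrite !addr0.
rewrite -mulnn -!cardsX; set D := setX [set u | P u == u] _.
(* A fixed point of [P] is known from its V0 part and either of the other two; [h] keeps the V1 part
   of the first and the V2 part of the second. *)
pose h uv := (p0 uv.2, p0 uv.1 + p1 uv.1 + p2 uv.2).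
have p2fix u : P u = u -> p2 u = P (p1 u) by move=> Pu; rewrite Pp1 Pu.
have h_inj : {in D &, injective h}.
  move=> [u v] [u' v']; rewrite !inE /= => /andP[/eqP Pu /eqP Pv].
  move=> /andP[/eqP Pu' /eqP Pv'] [eq_v0 eq_u].
  have eq_u0 : p0 u = p0 u'.
    have := congr1 p0 eq_u; rewrite !p0D.
    have [-> _ _] := pp0 u; have [-> _ _] := pp1 u; have [-> _ _] := pp2 v.
    have [-> _ _] := pp0 u'; have [-> _ _] := pp1 u'; have [-> _ _] := pp2 v'.
    by rewrite !addr0.
  have eq_u1 : p1 u = p1 u'.
    have := congr1 p1 eq_u; rewrite !p1D.
    have [_ -> _] := pp0 u; have [_ -> _] := pp1 u; have [_ -> _] := pp2 v.
    have [_ -> _] := pp0 u'; have [_ -> _] := pp1 u'; have [_ -> _] := pp2 v'.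
    by rewrite !addr0 !add0r.
  have eq_v2 : p2 v = p2 v' by move: eq_u; rewrite eq_u0 eq_u1 => /addrI.
  have p1fix w : P w = w -> p1 w = P (p2 w) by move=> Pw; rewrite Pp2 Pw.
  congr (_, _).
    by rewrite -(psum u) -(psum u') eq_u0 eq_u1 !p2fix // eq_u1.
  by rewrite -(psum v) -(psum v') eq_v0 eq_v2 !p1fix // eq_v2.
rewrite -(card_in_imset h_inj); apply: eq_card => -[w0 w].
rewrite !inE /=; apply/andP/imsetP => [[/eqP w0E /eqP PPw] | [[u v]]];
  last first.
  rewrite !inE /= => /andP[/eqP Pu /eqP Pv] [-> ->]; split; apply/eqP.
    by have [] := pp0 v.
  by rewrite !PD !Pp0 !(Pp1, Pp2) !Pu !Pv.
have pw0 : p1 w0 = 0 /\ p2 w0 = 0.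
  by rewrite -w0E; have [_ -> ->] := pp0 w0.
have [p0w1 p1w1 p2w1] := pp1 w; have [p0w2 p1w2 p2w2] := pp2 w.
have [p0w0 p1w0 p2w0] := pp0 w.
have PPp1 : P (P (p1 w)) = p1 w by rewrite Pp1 Pp2 PPw.
have PPp2 : P (P (p2 w)) = p2 w by rewrite Pp2 Pp1 PPw.
(* Each missing part is the image under [P] of the part that was kept. *)
exists (p0 w + p1 w + P (p1 w), w0 + p2 w + P (p2 w)).
  have Pw0 : P w0 = w0 by rewrite -w0E Pp0.
  by rewrite !inE /= !PD Pp0 Pw0 PPp1 PPp2 addrAC eqxx addrAC eqxx.
have [pPw1 pPw2] : p0 (P (p1 w)) = 0 /\ p0 (P (p2 w)) = 0 by rewrite !p0P.
rewrite /h /= !p0D !p1D !p2D pPw1 pPw2 p0w0 p0w1 p0w2 p1w0 p1w1 w0E pw0.2 p2w2.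
have -> : p1 (P (p1 w)) = 0 by rewrite Pp1; have [] := pp2 (P w).
have -> : p2 (P (p2 w)) = 0 by rewrite Pp2; have [] := pp1 (P w).
by rewrite !addr0 !add0r psum.
Qed.

Section SwapComponents.
Variables (V : finZmodType) (X : finType) (P : V -> V) (comp : X -> V -> V).
Variables (sigma : X -> X) (r : X -> nat).
Hypothesis PD : {morph P : u v / u + v}.
Hypothesis compD : forall x, {morph comp x : u v / u + v}.
Hypothesis comp_orth :
  forall x y u, comp x (comp y u) = if x == y then comp x u else 0.
Hypothesis comp_sum : forall u, \sum_x comp x u = u.
Hypothesis sigma_inj : injective sigma.
Hypothesis P_comp : forall x u, P (comp x u) = comp (sigma x) (P u).
Hypothesis r_sigma2 : forall x, r (sigma (sigma x)) = r x.
Hypothesis P_fix : forall x u, r (sigma x) = r x -> P (comp x u) = comp x u.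

(** The rank [r] orients the swaps: V0, V1 and V2 collect the components whose rank [sigma] keeps,
    raises or lowers, and [r_sigma2] makes [sigma] exchange the last two. *)
Lemma card_swap_components :
  (#|[set u | [forall x, (r (sigma x) != r x) ==> (comp x u == 0)%R]]| *
   #|[set u | P (P u) == u]| = #|[set u | P u == u]| ^ 2)%N.
Proof.
have morph0 (h : V -> V) : {morph h : u v / u + v} -> h 0 = 0.
  by move=> hD; apply: (addrI (h 0)); rewrite -hD !addr0.
pose pr (S : pred X) u := \sum_(x | S x) comp x u.
have comp_pr S x u : comp x (pr S u) = if S x then comp x u else 0.
  rewrite /pr (big_morph _ (compD x) (morph0 _ (compD x))) big_mkcond.
  rewrite (bigD1 x) //= comp_orth eqxx big1 ?addr0 // => y.
  by rewrite eq_sym comp_orth => /negPf->; case: ifP.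
have prD S : {morph pr S : u v / u + v}.
  by move=> u v; rewrite -big_split; apply: eq_bigr => x _; apply: compD.
have pr_pr S T u : pr S (pr T u) = pr (predI S T) u.
  by rewrite /pr [RHS]big_mkcondr; apply: eq_bigr => x _; apply: comp_pr.
have pr_id S u : pr S (pr S u) = pr S u.
  by rewrite pr_pr; apply: eq_bigl => x /=; rewrite andbb.
have P_pr S T u : (forall x, S x = T (sigma x)) -> P (pr S u) = pr T (P u).
  move=> ST; rewrite /pr (big_morph _ PD (morph0 _ PD)) [RHS](reindex_inj
    sigma_inj).
  by apply: eq_big => x; rewrite ?ST // P_comp.
pose S0 x := r (sigma x) == r x.
pose S1 x := (r x < r (sigma x))%N.
pose S2 x := (r (sigma x) < r x)%N.
have pr0 (S T : pred X) u : (forall x, S x -> ~~ T x) -> pr S (pr T u) = 0.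
  move=> ST; rewrite pr_pr; apply: big1 => x /= /andP[/ST] /negPf-> //.
have := @card_swap V P (pr S0) (pr S1) (pr S2) PD (prD _) (prD _) (prD _).
move=> swap; rewrite -swap {swap}.
- congr (_ * _)%N; apply: eq_card => u; rewrite !inE.
  apply/forallP/eqP => [u0 | uE x].
    rewrite /pr -[RHS]comp_sum big_mkcond; apply: eq_bigr => x _.
    by rewrite /S0; case: (r (sigma x) == r x) (u0 x) => //= /eqP.
  by apply/implyP => /negPf rx; rewrite -uE comp_pr /S0 rx.
- move=> u; rewrite -[RHS]comp_sum /pr (big_mkcond S0) (big_mkcond S1)
  (big_mkcond S2).
  rewrite -!big_split /=.
  by apply: eq_bigr => x _; rewrite /S0 /S1 /S2; case: ltngtP;
    rewrite ?add0r ?addr0.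
- by move=> u; split; [exact: (pr_id S0) | apply: (pr0 S1 S0) | apply: (pr0 S2
  S0)] => x;
    rewrite /S0 /S1 /S2; case: (ltngtP (r x) (r (sigma x))).
- by move=> u; split; [apply: (pr0 S0 S1) | exact: (pr_id S1) | apply: (pr0 S2
  S1)] => x;
    rewrite /S0 /S1 /S2; case: (ltngtP (r x) (r (sigma x))).
- by move=> u; split; [apply: (pr0 S0 S2) | apply: (pr0 S1 S2) | exact: (pr_id
  S2)] => x;
    rewrite /S0 /S1 /S2; case: (ltngtP (r x) (r (sigma x))).
- move=> u; rewrite /pr (big_morph _ PD (morph0 _ PD)); apply: eq_bigr => x.
  by move=> /eqP; apply: P_fix.
- by move=> u; apply: P_pr => x; rewrite /S1 /S2 r_sigma2.
- by move=> u; apply: P_pr => x; rewrite /S1 /S2 r_sigma2.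
Qed.

End SwapComponents.

(* The polynomial with roots u, Psi^2 u, Psi^4 u, ... has coefficients fixed by
   Psi^2, hence by Psi; so Psi u is one of its roots. *)
Lemma odd_period_rmorphism (R : finComNzRingType) (Psi : {rmorphism R -> R})
    (e : R) :
  injective Psi -> e * e = e -> Psi e = e ->
  (forall u v, e * (u * v) = 0 -> e * u = 0 \/ e * v = 0) ->
  (forall v, e * v = v -> Psi (Psi v) = v -> Psi v = v) ->
  forall u, e * u = u -> exists2 l, odd l & iter l Psi u = u.
Proof.
move=> Psi_inj ee Psie e_dom e_fix u eu.
pose Phi : {rmorphism R -> R} := Psi \o Psi.
have Phi_inj : injective Phi by apply: inj_comp.
have PhiE i : iter i Phi u = iter i.*2 Psi u.
  by elim: i => //= i ->.
set n := fingraph.order Phi u; have n0 : (0 < n)%N by apply: fingraph.order_gt0.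
pose P : {poly R} := \prod_(i < n) ('X - (iter i Phi u)%:P).
have PhiP : map_poly Phi P = P.
  rewrite rmorph_prod /P; under eq_bigr => i _ do rewrite rmorphB /= map_polyX
    map_polyC /=.
  (* [Phi] shifts the roots cyclically: the image of the last factor is the first one. *)
  rewrite -(prednK n0) big_ord_recr [RHS]big_ord_recl /= mulrC.
  congr (_ * _).
  have := iter_order Phi_inj u; rewrite -/n -{1}(prednK n0) /= => ->.
  by [].
have PsiP : map_poly Psi (e *: P) = e *: P.
  apply/polyP => j; rewrite coef_map coefZ; apply: e_fix; rewrite ?mulrA ?ee //.
  rewrite !rmorphM /= !Psie -[in RHS]PhiP coef_map; congr (_ * _).
have : (e *: P).[Psi u] = 0.
  rewrite -PsiP horner_map /= hornerZ horner_prod (bigD1 (Ordinal n0)) //=.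
  by rewrite hornerXsubC subrr mul0r mulr0 rmorph0.
rewrite hornerZ horner_prod => eP0.
have [i /eqP] : exists i : 'I_n, e * (Psi u - iter i Phi u) = 0.
  have dom_prod (r : seq 'I_n) (E : 'I_n -> R) :
      e * \prod_(i <- r) E i = 0 -> e = 0 \/ exists i, e * E i = 0.
    elim: r => [|i r IHr]; first by rewrite big_nil mulr1; left.
    by rewrite big_cons => /e_dom[|/IHr //]; right; exists i.
  have [e0 | [i]] := dom_prod _ _ eP0.
    by exists (Ordinal n0); rewrite e0 mul0r.
  by rewrite hornerXsubC; exists i.
rewrite mulrBr subr_eq0 -{1}Psie -rmorphM eu => /eqP Psiu.
apply: (@odd_period _ Psi Psi_inj i); rewrite Psiu PhiE.
elim: (val i).*2 => //= j IHj.
by rewrite -{1}Psie -rmorphM IHj.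
Qed.

(** * The twisted conjugation on F[A] and its odd periods *)

Section SemisimpleHull.
Variables (p nu t : nat) (F : finFieldType) (A : finZmodType).
Local Notation FA := (group_algebra F A).
Local Notation q := (p ^ nu)%N.
Local Notation Q := ((q * q) ^ t)%N.
Hypotheses (p_pr : prime p) (cardF : #|F| = (p ^ (2 * nu))%N).
Hypotheses (Q_gt1 : (1 < Q)%N) (mulQ : forall a : A, a *+ Q = a).
Implicit Types (u v : FA) (a : A).
Local Notation I := (primitive_type FA).
Local Notation conj := (@galg_conj p nu F A).
Local Notation conjI := (@conj_primitive p nu F A).

Definition negq a : A := - (a *+ q).
Definition conjq u : FA := conj u ^+ q.

(** [q] divides [Q], which acts on [A] as the identity. *)
Lemma negq_inj : injective negq.
Proof.
move=> a b /oppr_inj; have : (q %| Q)%N.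
  have t0 : (0 < t)%N by case: (t) Q_gt1.
  by rewrite -(prednK t0) expnS -mulnA dvdn_mulr.
by case/dvdnP => m Qm eq_ab; rewrite -(mulQ a) -(mulQ b) Qm mulnC !mulrnA eq_ab.
Qed.

(** The conjugation and the outer power each raise coefficients to the power [q], which together is
    the identity of [F]. *)
Lemma conjq_sum u : conjq u = \sum_a u a *: galg_mono F (negq a).
Proof.
rewrite /conjq {1}(galg_sum_mono u).
rewrite (big_morph _ (galg_conjD p_pr cardF) (galg_conj0 _ p_pr cardF)).
rewrite exprn_sum_pchar; last exact: pcharX_galg cardF _.
apply: eq_bigr => a _; rewrite galg_conjZ galg_conj_mono // galg_exprZ
  galg_monoX.
by rewrite -exprM -[(q * q)%N]expn1 (field_expX cardF) mulNrn.
Qed.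

Lemma conjqE u a : conjq u (negq a) = u a.
Proof.
rewrite conjq_sum galg_sumE (bigD1 a) //= galg_scaleE galg_monoE eqxx mulr1.
rewrite big1 ?addr0 // => b neq_ba; rewrite galg_scaleE galg_monoE.
by rewrite (inj_eq negq_inj) eq_sym (negPf neq_ba) mulr0.
Qed.

Lemma conjq_inj : injective conjq.
Proof. by move=> u v eq_uv; apply/ffunP => a; rewrite -conjqE eq_uv conjqE. Qed.

Lemma conjqB : {morph conjq : u v / u - v}.
Proof.
move=> u v; rewrite /conjq galg_conjB // exprB_pchar //;
  exact: pcharX_galg cardF _.
Qed.

Lemma conjqD : {morph conjq : u v / u + v}.
Proof.
move=> u v; rewrite /conjq galg_conjD // exprDn_pchar //;
  exact: pcharX_galg cardF _.
Qed.

Lemma conjqM : {morph conjq : u v / u * v}.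
Proof. by move=> u v; rewrite /conjq galg_conjM // exprMn. Qed.

Lemma conjq1 : conjq 1 = 1.
Proof. by rewrite /conjq galg_conj1 // expr1n. Qed.

Lemma conjq2 u : conjq (conjq u) = u ^+ #|F|.
Proof.
by rewrite /conjq galg_conjX // (galg_conjK cardF) -exprM -(cardFq cardF).
Qed.

Lemma conjqZ (c : F) u : conjq (c *: u) = c *: conjq u.
Proof.
rewrite !conjq_sum scaler_sumr; apply: eq_bigr => a _.
by rewrite galg_scaleE scalerA.
Qed.

Lemma conjq_mono a : conjq (galg_mono F a) = galg_mono F (negq a).
Proof. by rewrite /conjq galg_conj_mono // galg_monoX mulNrn. Qed.

Lemma conjq_primitive (e : I) : conjq (val e) = val (conjI e).
Proof.
rewrite (conj_primitiveE p_pr cardF) /conjq idem_exp ?q_gt0 //.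
by rewrite -galg_conjM // (primitive_id (valP e)).
Qed.

Lemma iter_conjqD n : {morph iter n conjq : u v / u + v}.
Proof. by elim: n => // n IHn u v; rewrite !iterS IHn conjqD. Qed.

Lemma iter_conjqM n : {morph iter n conjq : u v / u * v}.
Proof. by elim: n => // n IHn u v; rewrite !iterS IHn conjqM. Qed.

Lemma iter_conjqZ n (c : F) u : iter n conjq (c *: u) = c *: iter n conjq u.
Proof. by elim: n => // n IHn; rewrite !iterS IHn conjqZ. Qed.

Lemma iter_conjq_mono n a :
  iter n conjq (galg_mono F a) = galg_mono F (iter n negq a).
Proof. by elim: n => // n IHn; rewrite !iterS IHn conjq_mono. Qed.

Lemma iter_conjqE n u a : iter n conjq u (iter n negq a) = u a.
Proof. by elim: n => // n IHn; rewrite !iterS conjqE. Qed.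

(** The dichotomy with [z = 0]: then [x = 0], so each component is a field. *)
Lemma semisimple_inverse (e u : FA) : primitive_idem e -> u * e = u -> u != 0 ->
  exists w, u * w = e.
Proof.
move=> eP ue u0.
have mulQQ a : a *+ Q *+ Q = a *+ Q by rewrite !mulQ.
have mulQ_sub a : exists j, a = a *+ Q + 0 *+ j by exists 0%N;
  rewrite mulQ addr0.
have [//|] := primitive_dichotomy p_pr cardF Q_gt1 mulQQ mulQ_sub eP ue.
move=> /aug_divP[w]; rewrite /aug_gen galg_mono0 subrr expr1 mul0r => u_eq0.
by rewrite u_eq0 eqxx in u0.
Qed.

Lemma semisimple_domain (e u v : FA) : primitive_idem e ->
  e * (u * v) = 0 -> e * u = 0 \/ e * v = 0.
Proof.
move=> eP euv; have [-> | eu0] := eqVneq (e * u) 0; first by left.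
have [|w euw] := semisimple_inverse eP _ eu0.
  by rewrite mulrC mulrA (primitive_id eP).
by right; rewrite -euw mulrAC -[e * u * v]mulrA euv mul0r.
Qed.

(** ['X^#|F| - 'X] is the product of the ['X - c] over [c] in [F], and one of these factors must
    vanish at [v] in the component of [e]. *)
Lemma frobenius_fixed_scalar (e v : FA) : primitive_idem e -> e * v = v ->
  v ^+ #|F| = v -> exists c : F, v = c *: e.
Proof.
move=> eP ev vF.
have : (map_poly (in_alg FA) ('X^#|F| - 'X)).[v] = 0.
  by rewrite rmorphB /= map_polyXn map_polyX !hornerE ?hornerXn vF subrr.
rewrite finField_genPoly rmorph_prod horner_prod => prod0.
have dom_prod (s : seq F) (E : F -> FA) :
    e * \prod_(i <- s) E i = 0 -> exists i, e * E i = 0.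
  elim: s => [|i s IHs]; first by rewrite big_nil mulr1 => e0;
    have := primitive_neq0 eP; rewrite e0 eqxx.
  by rewrite big_cons => /(semisimple_domain eP)[|/IHs //]; exists i.
have := congr1 ( *%R e) prod0; rewrite mulr0 => /dom_prod[c].
rewrite rmorphB /= map_polyX map_polyC !hornerE /= mulrBr ev => /eqP.
by rewrite subr_eq0 -galg_scaleAr mulr1 => /eqP ->; exists c.
Qed.

(** The square of [conjq] is the Frobenius power [#|F|], whose fixed points in the component are the
    multiples of [val e]; the F-linear [conjq] fixes these. *)
Lemma fixed_primitive_odd_period (e : I) u : conjI e = e -> val e * u = u ->
  exists2 l, odd l & iter l conjq u = u.
Proof.
move=> fix_e eu; have eP := valP e.
pose conjqR : {rmorphism FA -> FA} := HB.pack conjq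
  (GRing.isZmodMorphism.Build FA FA conjq conjqB)
  (GRing.isMonoidMorphism.Build FA FA conjq (conjq1, conjqM)).
have conjqe : conjq (val e) = val e by rewrite conjq_primitive fix_e.
apply: (@odd_period_rmorphism _ conjqR (val e)) => //.
- exact: conjq_inj.
- exact: primitive_id.
- by move=> v w; apply: semisimple_domain.
move=> v ev; rewrite /= conjq2 => /(frobenius_fixed_scalar eP ev)[c ->].
by rewrite conjqZ conjqe.
Qed.

Local Notation negq2 := (fun a : A => a *+ p ^ (2 * nu)).

Lemma negq2E a : a *+ p ^ (2 * nu) = negq (negq a).
Proof. by rewrite /negq mulNrn opprK -mulrnA mul2n -addnn expnD. Qed.

Lemma negq2_inj : injective negq2.
Proof. by move=> a b /=; rewrite !negq2E => /negq_inj/negq_inj. Qed.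

(** Numbers the cyclotomic classes through chosen representatives, to serve as the rank in
    [card_swap_components]. *)
Definition orbit_rank a : nat := enum_rank (froot negq2 a).

Lemma orbit_rank_eq a b : (orbit_rank a == orbit_rank b) = fconnect negq2 a b.
Proof.
rewrite /orbit_rank (inj_eq val_inj) (inj_eq enum_rank_inj).
by rewrite (root_connect (fconnect_sym negq2_inj)).
Qed.

Lemma mem_R_class a :
  (a \in R_class p nu A) = (orbit_rank (negq a) == orbit_rank a).
Proof. by rewrite !inE eq_sym orbit_rank_eq. Qed.

Lemma iter_negq2 n a : iter n negq2 a = iter n.*2 negq a.
Proof. by elim: n => //= n ->; rewrite negq2E. Qed.

Lemma orbit_rank_odd n a : odd n ->
  orbit_rank (iter n negq a) = orbit_rank (negq a).
Proof.
move=> n_odd; rewrite -[n]odd_double_half n_odd add1n iterSr -iter_negq2.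
by apply/esym/eqP; rewrite orbit_rank_eq fconnect_iter.
Qed.

Lemma iter_conjq_odd n (e : I) : odd n -> iter n conjq (val e) = val (conjI e).
Proof.
have iterE m : iter m conjq (val e) = val (iter m conjI e).
  by elim: m => //= m ->; rewrite conjq_primitive.
move=> n_odd; rewrite iterE -[n]odd_double_half n_odd add1n iterS.
have conjIK : involutive conjI by exact: conj_primitiveK.
by elim: n./2 => //= m IHm; rewrite conjIK.
Qed.

(** For [a] in R, [negq a] is an even iterate of [negq] at [a], so its period is odd. The product
    with an odd period common to the self-conjugate components serves both. *)
Lemma common_period : exists n, [/\ odd n,
  forall a, a \in R_class p nu A -> iter n negq a = a &
  forall (e : I) u, conjI e = e -> val e * u = u -> iter n conjq u = u].
Proof.
have [|m m_odd mP] := common_odd_period (f := negq) (S := mem (R_class p nu A)).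
  move=> a aR; have : a \in R_class p nu A by [].
  rewrite mem_R_class eq_sym orbit_rank_eq => /iter_findex.
  by rewrite iter_negq2 => /esym; apply/odd_period/negq_inj.
pose S := [pred u : FA | [exists e : I, (conjI e == e) && (val e * u == u)]].
have [|n n_odd nP] := common_odd_period (f := conjq) (S := S).
  move=> u /existsP[e /andP[/eqP fix_e /eqP eu]].
  exact: fixed_primitive_odd_period fix_e eu.
exists (m * n)%N; split; first by rewrite oddM m_odd.
  by move=> a aR; rewrite mulnC; apply/iter_mul_period/mP.
move=> e u fix_e eu; apply/iter_mul_period/nP.
by apply/existsP; exists e; rewrite fix_e eu !eqxx.
Qed.

(** The components are the single coefficients; the functions supported on R form the part fixed
    pointwise. *)
Lemma card_swap_R_class n : odd n ->
  (forall a, a \in R_class p nu A -> iter n negq a = a) ->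
  (#|F| ^ #|R_class p nu A| *
     #|[set u | iter n conjq (iter n conjq u) == u]| =
   #|[set u | iter n conjq u == u]| ^ 2)%N.
Proof.
move=> n_odd nP.
pose comp a u : FA := u a *: galg_mono F a.
have orbit_rankE a : orbit_rank (iter n negq a) = orbit_rank (negq a).
  exact: orbit_rank_odd.
rewrite -(card_swap_components (comp := comp) (sigma := iter n negq)
  (r := orbit_rank)).
- congr (_ * _)%N; rewrite -(card_pffun_on 0 (mem (R_class p nu A)) predT).
  apply: eq_card => u; rewrite [RHS]inE; apply/pffun_onP/forallP => [[u_supp
    _] a | u0].
    apply/implyP; rewrite orbit_rankE -mem_R_class => aR; apply/eqP.
    rewrite /comp; have [->|ua] := eqVneq (u a) 0; first by rewrite scale0r.
    by case/negP: aR; apply: (subsetP u_supp).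
  split=> //; apply/subsetP => a; rewrite inE; apply: contraR => aR.
  have := u0 a; rewrite orbit_rankE -mem_R_class aR => /eqP/ffunP/(_ a).
  by rewrite galg_scaleE galg_monoE eqxx mulr1 ffunE => ->.
- exact: iter_conjqD.
- by move=> a u v; rewrite /comp -scalerDl ffunE.
- move=> a b u; rewrite /comp galg_scaleE galg_monoE; case: eqP => [-> | _].
    by rewrite mulr1.
  by rewrite mulr0 scale0r.
- by move=> u; rewrite -galg_sum_mono.
- by elim: (n) => [|m IHm] a b //= /negq_inj/IHm.
- by move=> a u; rewrite /comp iter_conjqZ iter_conjq_mono iter_conjqE.
- move=> a; rewrite -iterD addnn -iter_negq2.
  by apply/esym/eqP; rewrite orbit_rank_eq fconnect_iter.
- move=> a u; rewrite orbit_rankE => /eqP; rewrite -mem_R_class => /nP.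
  by rewrite /comp iter_conjqZ iter_conjq_mono => ->.
Qed.

Lemma card_swap_primitive n : odd n ->
  (forall (e : I) u, conjI e = e -> val e * u = u -> iter n conjq u = u) ->
  (#|[set u : FA | [forall e : I, (conjI e != e) ==> (val e * u == 0)%R]]| *
     #|[set u | iter n conjq (iter n conjq u) == u]| =
   #|[set u | iter n conjq u == u]| ^ 2)%N.
Proof.
move=> n_odd nP; have conjIK : involutive conjI by exact: conj_primitiveK.
pose comp (e : I) u : FA := val e * u.
rewrite -(card_swap_components (comp := comp) (sigma := conjI)
  (r := fun e => enum_rank e : nat)).
- congr (_ * _)%N; apply: eq_card => u; rewrite !inE; apply: eq_forallb => e.
  by rewrite (inj_eq val_inj) (inj_eq enum_rank_inj).
- exact: iter_conjqD.
- by move=> e u v; rewrite /comp mulrDr.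
- move=> e f u; rewrite /comp mulrA primitive_orthI.
  by case: eqP => // _; rewrite mul0r.
- by move=> u; rewrite -primitive_decomp.
- exact: inv_inj conjIK.
- by move=> e u; rewrite /comp iter_conjqM iter_conjq_odd.
- by move=> e; rewrite conjIK.
move=> e u /val_inj/enum_rank_inj fix_e; apply: nP fix_e _.
by rewrite /comp mulrA (primitive_id (valP e)).
Qed.

(** The two swap counts share their right-hand side and the positive factor counting the fixed
    points of P^2. Cancelling it equates the sizes of two fixed parts, hence their dimensions. *)
Lemma sum_fixed_residue_dim :
  (\sum_(e | conjI e == e) @residue_dim p 0 F A 0%R e = #|R_class p nu A|)%N.
Proof.
have mulQQ a : a *+ Q *+ Q = a *+ Q by rewrite !mulQ.
have mulQ_sub a : exists j, a = a *+ Q + 0 *+ j by exists 0%N;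
  rewrite mulQ addr0.
have zQ : (0 : A) *+ Q = 0 by rewrite mul0rn.
have zN : (0 : A) *+ p ^ 0 = 0 by rewrite mul0rn.
have z_order j : (j < p ^ 0)%N -> (0 : A) *+ j = 0 -> j = 0%N by case: j.
have [n [n_odd nR nI]] := common_period.
have B_gt0 : (0 < #|[set u : FA | iter n conjq (iter n conjq u) == u]|)%N.
  have iter0 : iter n conjq 0 = 0.
    by rewrite -{1}(scale0r (0 : FA)) iter_conjqZ scale0r.
  by apply/card_gt0P; exists 0; rewrite inE !iter0.
have := card_swap_R_class n_odd nR; rewrite -(card_swap_primitive n_odd nI).
move/eqP; rewrite eqn_pmul2r // eq_sym.
(* Here [N = 1]: exponent 0 keeps a component whole and exponent 1 kills it. *)
pose s : {ffun I -> 'I_(p ^ 0).+1} :=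
  [ffun e => if conjI e == e then ord0 else ord_max].
have -> : #|[set u : FA | [forall e : I, (conjI e != e) ==> (val e * u == 0)]]|
    = #|code_of 0 s|.
  apply: eq_card => u; rewrite !inE; apply: eq_forallb => e; rewrite ffunE.
  case: eqP => _ /=; first by rewrite aug_div0.
  by rewrite (aug_div_eq0 p_pr cardF zN).
rewrite (card_ideal (code_of_ideal 0 s)) eqn_exp2l ?finNzRing_gt1 // => /eqP <-.
rewrite (code_dim_code_of p_pr cardF Q_gt1 mulQQ mulQ_sub zQ zN z_order).
rewrite big_mkcond; apply: eq_bigr => e _; rewrite ffunE.
by case: eqP => _ /=; rewrite ?subn0 ?subnn ?muln1 ?muln0.
Qed.

End SemisimpleHull.

Lemma mulrn_card (A : finZmodType) (a : A) : a *+ #|A| = 0.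
Proof.
rewrite -FinRing.zmodXgE -cardsT; apply/eqP.
by rewrite -(FinRing.zmod1gE A) -order_dvdn order_dvdG ?inE.
Qed.

Lemma mulrn_modn (A : finZmodType) (a : A) n n' :
  n = n' %[mod #|A|] -> a *+ n = a *+ n'.
Proof.
move=> eq_n; rewrite (divn_eq n #|A|) (divn_eq n' #|A|) eq_n.
by rewrite !mulrnDr ![(_ * #|A|)%N]mulnC !mulrnA mulrn_card !mul0rn.
Qed.

Lemma pair_mulrn (U V : zmodType) (a : U) (b : V) n :
  (a, b) *+ n = (a *+ n, b *+ n).
Proof. by elim: n => // n IHn; rewrite !mulrS IHn. Qed.

Lemma cyclic_mulrnE n (b : cyclic_group n) j : (0 < n)%N ->
  (b *+ j : cyclic_group n) = (b * j %% n)%N :> nat.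
Proof.
case: n b => // n b _; elim: j => [|j IHj]; first by rewrite muln0 mod0n.
by rewrite mulrS mulnS /= IHj modnDmr.
Qed.

(** * Projecting [A * cyclic_group (p ^ k)] onto [A] by an integer multiple *)

Section SplitGroup.
Variables (p nu : nat) (F : finFieldType) (A : finZmodType).
Local Notation q := (p ^ nu)%N.
Hypotheses (p_pr : prime p) (nu_gt0 : (0 < nu)%N).
Hypotheses (cardF : #|F| = (p ^ (2 * nu))%N) (p_ndvd : ~~ (p %| #|A|)%N).

(* Euler's theorem gives Q = 1 modulo #|A|, and the factor k.+1 makes p ^ k
   divide Q. *)
Definition split_period k := (totient #|A| * k.+1)%N.
Local Notation Q k := ((q * q) ^ split_period k)%N.

Lemma cardA_gt0 : (0 < #|A|)%N.
Proof. by apply/card_gt0P; exists 0. Qed.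

Lemma split_period_gt0 k : (k < split_period k)%N.
Proof.
by rewrite leq_pmull // totient_gt0 cardA_gt0.
Qed.

Lemma split_exp_gt1 k : (1 < Q k)%N.
Proof.
rewrite qq_pow -{1}(expn0 p) ltn_exp2l ?prime_gt1 //.
by rewrite 2!muln_gt0 nu_gt0 (leq_ltn_trans _ (split_period_gt0 k)).
Qed.

Lemma mulrn_split k (a : A) : a *+ Q k = a.
Proof.
rewrite -[RHS]mulr1n; apply: mulrn_modn; rewrite expnM -modnXm
  Euler_exp_totient.
  by rewrite modnXm exp1n.
by rewrite coprimeMl andbb coprimeXl // prime_coprime.
Qed.

(** With [z = 0] and [N = 1], a self-conjugate component contributes 0 and any other d_e/4. *)
Lemma avg_hull_semisimple :
  avg_hermitian_hull p nu F A = (#|A|%:R - #|R_class p nu A|%:R) / 4.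
Proof.
have Q1 := split_exp_gt1 0; have mulQ := @mulrn_split 0.
have mulQQ (a : A) : a *+ Q 0 *+ Q 0 = a *+ Q 0 by rewrite !mulQ.
have mulQ_sub (a : A) : exists j, a = a *+ Q 0 + 0 *+ j.
  by exists 0%N; rewrite mulQ addr0.
have zQ : (0 : A) *+ Q 0 = 0 by rewrite mul0rn.
have zN : (0 : A) *+ p ^ 0 = 0 by rewrite mul0rn.
have z_order j : (j < p ^ 0)%N -> (0 : A) *+ j = 0 -> j = 0%N by case: j.
rewrite (avg_hullE p_pr cardF Q1 mulQQ mulQ_sub zQ zN z_order).
rewrite -(sum_fixed_residue_dim p_pr cardF Q1 mulQ).
rewrite -(sum_residue_dim p_pr cardF Q1 mulQQ mulQ_sub zQ zN z_order).
have -> : min_sum1 (p ^ 0) = 0%N by rewrite /min_sum1 !big_ord_recl big_ord0.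
have -> : min_sum2 (p ^ 0) = 1%N by rewrite /min_sum2 !big_ord_recl !big_ord0.
rewrite !natr_sum [X in _ - X]big_mkcond -sumrB mulr_suml;
  apply: eq_bigr => e _.
by rewrite muln1; case: ifP => _; rewrite ?subrr ?mul0r ?mulr0 ?subr0 ?mul1r.
Qed.

Lemma avg_hull_cyclic_lt k :
  avg_hermitian_hull p nu F (A * cyclic_group (p ^ k))%type
    < (#|A| * p ^ k)%:R / 3.
Proof.
have N0 : (0 < p ^ k)%N by rewrite expn_gt0 prime_gt0.
have -> : (#|A| * p ^ k)%N = #|{: A * cyclic_group (p ^ k)}|.
  by rewrite card_prod card_ord prednK.
have N_Q : (p ^ k %| Q k)%N.
  rewrite qq_pow dvdn_exp2l //; have := split_period_gt0 k.
  by move: nu_gt0; nia.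
have mulN j (b : cyclic_group (p ^ k)) : (p ^ k %| j)%N -> b *+ j = 0.
  move=> dvd_j; apply: ord_inj; rewrite cyclic_mulrnE //.
  by apply/eqP; rewrite -/(dvdn _ _) dvdn_mull.
(* The remainder covers [k = 0], where the group is trivial and its generator is 0. *)
pose one : cyclic_group (p ^ k) := inord (1 %% p ^ k).
have oneE j : one *+ j = (j %% p ^ k)%N :> nat.
  by rewrite cyclic_mulrnE // /one inordK ?prednK ?ltn_mod // modnMml mul1n.
have gQ (g : A * cyclic_group (p ^ k)) : g *+ Q k = (g.1, 0).
  by case: g => a b; rewrite pair_mulrn mulrn_split mulN.
apply: (@avg_hull_lt p nu k (split_period k) F _ (0, one)) => //.
- exact: split_exp_gt1.
- by move=> g; rewrite !gQ.
- case=> a b; exists (val b); rewrite gQ pair_mulrn mul0rn.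
  congr (_, _); first by rewrite addr0.
  rewrite add0r; apply: ord_inj; rewrite oneE modn_small //.
  by apply: leq_trans (ltn_ord b) _; rewrite prednK.
- by rewrite pair_mulrn mul0rn mulN.
move=> j lt_jN; rewrite pair_mulrn => -[_ /(congr1 (@nat_of_ord _))].
by rewrite oneE modn_small.
Qed.

End SplitGroup.

Theorem corollary4p1 (p nu k m : nat) (F : finFieldType) (A : finZmodType)
    (p_prime : prime p) (nu_gt0 : (0 < nu)%N)
    (cardF : #|F| = (p ^ (2 * nu))%N)
    (cardA : #|A| = m) (p_ndvd_m : ~~ (p %| m)%N) :
  [/\ avg_hermitian_hull p nu F (A * cyclic_group (p ^ k))%type
        < (m * p ^ k)%:R / 3,
      avg_hermitian_hull p nu F A = (m%:R - #|R_class p nu A|%:R) / 4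
    & avg_hermitian_hull p nu F A <= (m%:R - 1) / 4].
Proof.
subst m; split.
- exact: avg_hull_cyclic_lt.
- exact: avg_hull_semisimple.
rewrite avg_hull_semisimple // ler_pM2r ?invr_gt0 // lerB // ler1n.
(* R contains 0, so it has at least one element. *)
apply/card_gt0P; exists 0; rewrite inE; apply/cyclotomic_classP.
by exists 0%N; rewrite mul0rn oppr0.
Qed.
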